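(* Let $\Lambda$ be a row-finite $\mathbb{N}$-graph with no sources which is aperiodic. Let $J$ be a gauge-invariant regular ideal of $C^{*}(\Lambda)$. Then the $\mathbb{N}$-graph $\Lambda \setminus H(J)$ is aperiodic.
   Context: $\mathbb{N}^{\mathbb{N}}_{0}$ is the monoid of sequences of nonnegative integers with only finitely many nonzero entries, with entrywise addition and entrywise order; $m\vee n$ is the entrywise maximum. An $\mathbb{N}$-graph $(\Lambda,d)$ is a countable small category $\Lambda$ with range and source maps $r,s$ ($\lambda\mu$ is defined when $s(\lambda)=r(\mu)$) and a functor $d:\Lambda\to\mathbb{N}^{\mathbb{N}}_{0}$ with the factorization property: whenever $d(\lambda)=m+n$ there are unique $\mu,\nu\in\Lambda$ with $\lambda=\mu\nu$, $d(\mu)=m$, $d(\nu)=n$. Put $\Lambda^n=d^{-1}(n)$; $\Lambda^0$ is identified with the objects. For $v\in\Lambda^0$, $v\Lambda=\{\lambda\in\Lambda:r(\lambda)=v\}$ and $v\Lambda^n=v\Lambda\cap\Lambda^n$. $\Lambda$ is row-finite if every $v\Lambda^n$ is finite, and has no sources if every $v\Lambda^n$ is nonempty. For $\lambda\in\Lambda$ and $p\le q\le d(\lambda)$, $\lambda(p,q)$ is the unique path $\lambda''$ of degree $q-p$ in the factorization $\lambda=\lambda'\lambda''\lambda'''$ with $d(\lambda')=p$, $d(\lambda'')=q-p$. $\Lambda$ is aperiodic if for each $v\in\Lambda^0$ and each pair $n\ne m$ in $\mathbb{N}^{\mathbb{N}}_{0}$ there is $\lambda\in v\Lambda$ with $d(\lambda)\ge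 m\vee n$ and $\lambda(m,m+d(\lambda)-(m\vee n))\neq\lambda(n,n+d(\lambda)-(m\vee n))$. $C^*(\Lambda)$ is the universal $C^*$-algebra generated by partial isometries $\{s_\lambda:\lambda\in\Lambda\}$ such that (CK1) $\{s_v:v\in\Lambda^0\}$ are mutually orthogonal projections; (CK2) $s_{\lambda}s_\mu=s_{\lambda\mu}$ if $s(\lambda)=r(\mu)$ and $s_\lambda s_\mu=0$ otherwise; (CK3) $s_\lambda^*s_\lambda=s_{s(\lambda)}$; (CK4) $s_v=\sum_{\lambda\in v\Lambda^n}s_\lambda s_\lambda^*$ for all $v\in\Lambda^0$, $n\in\mathbb{N}^{\mathbb{N}}_{0}$. One writes $p_v=s_v$ for $v\in\Lambda^0$. The gauge action $\alpha$ of $\mathbb{T}^\omega=\prod_{\mathbb{N}}\mathbb{T}$ is given by $\alpha_t(s_\lambda)=t^{d(\lambda)}s_\lambda$, $t^m=t_1^{m_1}t_2^{m_2}\cdots$; an ideal $J$ is gauge-invariant if $\alpha_t(J)\subseteq J$ for all $t$. An ideal $J$ of an algebra $A$ is regular if $J^{\perp\perp}=J$, where $J^\perp=\{a\in A: ax=xa=0\ \forall x\in J\}$. For an ideal $J$ of $C^*(\Lambda)$, $H(J)=\{v\in\Lambda^0:p_v\in J\}$, a saturated hereditary set (hereditary: $r(\lambda)\in H\Rightarrow s(\lambda)\in H$; saturated: $s(v\Lambda^n)\subseteq H$ for some $n$ implies $v\in H$). $\Lambda\setminus H$ is the category with objects $\Lambda^0\setminus H$ and morphisms $\{\lambda\in\Lambda:r(\lambda),s(\lambda)\in\Lambda^0\setminus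 H\}$, with degree map inherited from $\Lambda$; for $H$ saturated and hereditary it is a row-finite $\mathbb{N}$-graph with no sources. *)

(* Defs.v *)
From HB Require Import structures.
From mathcomp Require Import all_boot all_order all_algebra.
From mathcomp Require Import finmap multiset complex.
From mathcomp Require Import all_classical all_reals all_analysis.
Set Implicit Arguments.
Unset Strict Implicit.
Unset Printing Implicit Defensive.
Import Order.TTheory GRing.Theory Num.Theory.
Import numFieldNormedType.Exports.

Declare Scope cstar_scope.
Delimit Scope cstar_scope with CS.

Local Open Scope classical_set_scope.
Local Open Scope ring_scope.
Local Open Scope complex_scope.

(* The monoid of finitely supported sequences of nonnegative integers is the
   type {mset nat} of finitely supported functions nat -> nat.  Its operations
   are entrywise: `+` is the sum, `\` the truncated difference, `|` the
   maximum, `<=` the order, and mset0 is the zero sequence. *)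
Notation degree := {mset nat}%mset.

(* Composition is a total function: mcomp f g is the composite fg when
   src f = rng g, and is unspecified otherwise. Countability of the category
   is carried by the countType structures. *)
Record Ngraph := MkNgraph {
  vertex : countType;
  mor : countType;
  src : mor -> vertex;
  rng : mor -> vertex;
  idm : vertex -> mor;
  mcomp : mor -> mor -> mor;
  deg : mor -> degree;
  src_idm : forall v, src (idm v) = v;
  rng_idm : forall v, rng (idm v) = v;
  src_comp : forall f g, src f = rng g -> src (mcomp f g) = src g;
  rng_comp : forall f g, src f = rng g -> rng (mcomp f g) = rng f;
  comp_idl : forall f, mcomp (idm (rng f)) f = f;
  comp_idr : forall f, mcomp f (idm (src f)) = f;
  compA : forall f g h, src f = rng g -> src g = rng h ->
    mcomp f (mcomp g h) = mcomp (mcomp f g) h;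
  deg_idm : forall v, deg (idm v) = mset0;
  deg_comp : forall f g, src f = rng g ->
    deg (mcomp f g) = (deg f `+` deg g)%mset;
  factorization : forall f (m n : degree), deg f = (m `+` n)%mset ->
    exists! gh : mor * mor,
      [/\ src gh.1 = rng gh.2, f = mcomp gh.1 gh.2,
          deg gh.1 = m & deg gh.2 = n]
}.

Section NgraphDefs.
Variable L : Ngraph.

(* v L^n *)
Definition paths_from (v : vertex L) (n : degree) : set (mor L) :=
  [set f | rng f = v /\ deg f = n].

Definition row_finite := forall v n, finite_set (paths_from v n).

Definition no_sources := forall v n, paths_from v n !=set0.

Definition is_segment (f : mor L) (p q : degree) (g : mor L) : Prop :=
  exists g' g'' : mor L,
    [/\ src g' = rng g, src g = rng g'', f = mcomp g' (mcomp g g''),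
        deg g' = p & deg g = (q `\` p)%mset].

(* f(p, q); meaningful only for p <= q <= deg f, where is_segment f p q holds
   of exactly one path. *)
Definition segment (f : mor L) (p q : degree) : mor L :=
  xget f [set g | is_segment f p q g].

Definition aperiodic := forall (v : vertex L) (m n : degree), m <> n ->
  exists f : mor L,
    [/\ rng f = v, ((m `|` n) `<=` deg f)%mset &
        segment f m ((m `+` deg f) `\` (m `|` n))%mset <>
        segment f n ((n `+` deg f) `\` (m `|` n))%mset].

Definition hereditary (H : set (vertex L)) :=
  forall f : mor L, H (rng f) -> H (src f).

Variable H : set (vertex L).
Hypothesis hH : hereditary H.

Definition vertexD := {v : vertex L | v \notin H}.
Definition morD := {f : mor L | (rng f \notin H) && (src f \notin H)}.

Lemma rngD_subproof (f : morD) : rng (val f) \notin H.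
Proof. by case/andP: (valP f). Qed.
Lemma srcD_subproof (f : morD) : src (val f) \notin H.
Proof. by case/andP: (valP f). Qed.
Lemma idmD_subproof (v : vertexD) :
  (rng (idm (val v)) \notin H) && (src (idm (val v)) \notin H).
Proof. by rewrite rng_idm src_idm (valP v). Qed.

Definition srcD (f : morD) : vertexD := Sub (src (val f)) (srcD_subproof f).
Definition rngD (f : morD) : vertexD := Sub (rng (val f)) (rngD_subproof f).
Definition idmD (v : vertexD) : morD := Sub (idm (val v)) (idmD_subproof v).
(* the default value f is only used for non-composable f, g *)
Definition compD (f g : morD) : morD := insubd f (mcomp (val f) (val g)).
Definition degD (f : morD) : degree := deg (val f).

Lemma srcD_rngD f g : srcD f = rngD g -> src (val f) = rng (val g).
Proof. by move/(congr1 val). Qed.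

Lemma val_compD f g : srcD f = rngD g ->
  val (compD f g) = mcomp (val f) (val g).
Proof.
move=> /srcD_rngD fg; rewrite val_insubd.
by rewrite rng_comp // src_comp // rngD_subproof srcD_subproof.
Qed.

Lemma factorizationD (f : morD) (m n : degree) : degD f = (m `+` n)%mset ->
  exists! gh : morD * morD,
    [/\ srcD gh.1 = rngD gh.2, f = compD gh.1 gh.2,
        degD gh.1 = m & degD gh.2 = n].
Proof.
move=> /factorization [[g h] [[/= gh fE dg dh] uniq_gh]].
have rg : rng g \notin H by rewrite -(rng_comp gh) -fE rngD_subproof.
have sh : src h \notin H by rewrite -(src_comp gh) -fE srcD_subproof.
have rh : rng h \notin H.
  by apply/negP => /set_mem/hH/mem_set; rewrite (negbTE sh).
have hg : (rng g \notin H) && (src g \notin H) by rewrite rg gh rh.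
have hh : (rng h \notin H) && (src h \notin H) by rewrite rh sh.
have ghD : srcD (Sub g hg) = rngD (Sub h hh) by apply/val_inj.
exists (Sub g hg, Sub h hh); split => [|[g' h'] /= [gh' fE' dg' dh']].
  by split=> //=; apply/val_inj; rewrite val_compD.
have ghP' : [/\ src (val g') = rng (val h'),
    val f = mcomp (val g') (val h'), deg (val g') = m & deg (val h') = n].
  by split=> //; [exact: srcD_rngD | rewrite fE' val_compD].
case: (uniq_gh (val g', val h') ghP') => gE hE.
by congr (_, _); apply/val_inj.
Qed.

(* L \ H: the full subcategory on the vertices outside H *)
Definition NgraphD : Ngraph.
Proof.
refine (@MkNgraph vertexD morD srcD rngD idmD compD degD
          _ _ _ _ _ _ _ _ _ factorizationD).
- by move=> v; apply/val_inj; rewrite /= src_idm.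
- by move=> v; apply/val_inj; rewrite /= rng_idm.
- move=> f g fg; apply/val_inj; rewrite /= val_compD //.
  by rewrite src_comp //; exact: srcD_rngD.
- move=> f g fg; apply/val_inj; rewrite /= val_compD //.
  by rewrite rng_comp //; exact: srcD_rngD.
- move=> f; apply/val_inj; rewrite val_compD ?comp_idl //=.
  by apply/val_inj; rewrite /= src_idm.
- move=> f; apply/val_inj; rewrite val_compD ?comp_idr //=.
  by apply/val_inj; rewrite /= rng_idm.
- move=> f g h fg gh; have fg' := srcD_rngD fg; have gh' := srcD_rngD gh.
  have fgh : srcD f = rngD (compD g h).
    by apply/val_inj; rewrite /= val_compD // rng_comp.
  have fgh' : srcD (compD f g) = rngD h.
    by apply/val_inj; rewrite /= val_compD // src_comp.
  by apply/val_inj; rewrite !val_compD // compA.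
- by move=> v; rewrite /degD /= deg_idm.
- by move=> f g fg; rewrite /degD val_compD // deg_comp //; exact: srcD_rngD.
Defined.

End NgraphDefs.

(* A complex C*-algebra, not assumed to be unital. *)
Record cstar_alg (R : realType) := MkCstarAlg {
  cs_car :> completeNormedModType R[i];
  cs_mul : cs_car -> cs_car -> cs_car;
  cs_star : cs_car -> cs_car;
  cs_mulA : forall x y z, cs_mul x (cs_mul y z) = cs_mul (cs_mul x y) z;
  cs_mulDl : forall x y z, cs_mul (x + y) z = cs_mul x z + cs_mul y z;
  cs_mulDr : forall x y z, cs_mul x (y + z) = cs_mul x y + cs_mul x z;
  cs_scalel : forall (a : R[i]) x y, cs_mul (a *: x) y = a *: cs_mul x y;
  cs_scaler : forall (a : R[i]) x y, cs_mul x (a *: y) = a *: cs_mul x y;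
  cs_normM : forall x y, `|cs_mul x y| <= `|x| * `|y|;
  cs_starK : forall x, cs_star (cs_star x) = x;
  cs_starD : forall x y, cs_star (x + y) = cs_star x + cs_star y;
  cs_starZ : forall (a : R[i]) x,
    cs_star (a *: x) = Num.conj a *: cs_star x;
  cs_starM : forall x y, cs_star (cs_mul x y) = cs_mul (cs_star y) (cs_star x);
  cs_norm : forall x, `|cs_mul (cs_star x) x| = `|x| ^+ 2
}.

Notation "x ** y" := (cs_mul x y)
  (at level 40, left associativity) : cstar_scope.
Notation "x ^#" := (cs_star x)
  (format "x ^#") : cstar_scope.
Local Open Scope cstar_scope.

Section CstarDefs.
Variable R : realType.

Definition star_hom (A B : cstar_alg R) (f : A -> B) : Prop :=
  [/\ linear f,
      forall x y, f (x ** y) = f x ** f y &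
      forall x, f x^# = (f x)^#].

Variable A : cstar_alg R.

Definition subspace (D : set A) : Prop :=
  D 0 /\ forall (a : R[i]) x y, D x -> D y -> D (a *: x + y).

Definition star_subalgebra (D : set A) : Prop :=
  [/\ subspace D, forall x y, D x -> D y -> D (x ** y) &
      forall x, D x -> D x^#].

(* the C*-algebra generated by S is the whole of A *)
Definition generates (S : set A) : Prop :=
  forall D : set A, closed D -> star_subalgebra D -> S `<=` D -> D = setT.

(* Two-sided ideal. Closedness is not required here: an annihilator is always
   closed, so it holds for every regular ideal. *)
Definition ideal (J : set A) : Prop :=
  subspace J /\ forall a x, J x -> J (a ** x) /\ J (x ** a).

Definition annihilator (J : set A) : set A :=
  [set a | forall x, J x -> a ** x = 0 /\ x ** a = 0].

Definition regular_ideal (J : set A) : Prop :=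
  ideal J /\ annihilator (annihilator J) = J.

End CstarDefs.

Section GraphCstar.
Variables (R : realType) (L : Ngraph).

(* The sum in the last clause is over the set v L^n, which is finite when L is
   row-finite. *)
Record CK_family (A : cstar_alg R) (s : mor L -> A) : Prop := MkCK {
  CK_partial_isometry : forall f, s f ** (s f)^# ** s f = s f;
  CK1_proj : forall v, (s (idm v))^# = s (idm v) /\
    s (idm v) ** s (idm v) = s (idm v);
  CK1_orth : forall v w, v <> w -> s (idm v) ** s (idm w) = 0;
  CK2_comp : forall f g, src f = rng g -> s f ** s g = s (mcomp f g);
  CK2_zero : forall f g, src f <> rng g -> s f ** s g = 0;
  CK3 : forall f, (s f)^# ** s f = s (idm (src f));
  CK4 : forall (v : vertex L) (n : degree),
    s (idm v) = \sum_(f \in paths_from v n) (s f ** (s f)^#)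
}.

(* (A, s) is the universal C*-algebra C*(L) with its generators *)
Record is_graph_cstar (A : cstar_alg R) (s : mor L -> A) : Prop :=
  MkGraphCstar {
  gc_CK : CK_family s;
  gc_gen : generates (range s);
  gc_univ : forall (B : cstar_alg R) (S : mor L -> B), CK_family S ->
    exists pi : A -> B, star_hom pi /\ forall f, pi (s f) = S f
}.

Definition torus := {t : nat -> R[i] | forall i, `|t i| = 1}.

Definition torus_pow (t : torus) (m : degree) : R[i] :=
  \prod_(i <- finsupp m) sval t i ^+ m i.

Lemma torus_pow_widen (t : torus) (m : degree) (X : {fset nat}) :
  (finsupp m `<=` X)%fset ->
  torus_pow t m = \prod_(i <- X) sval t i ^+ m i.
Proof.
move=> mX; rewrite /torus_pow; apply: big_fset_incl => // i _ /=.
by move=> /fsfun_dflt ->; rewrite expr0.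
Qed.

Lemma torus_pow0 (t : torus) : torus_pow t mset0 = 1.
Proof. by rewrite /torus_pow big1 // => i _; rewrite mset0E expr0. Qed.

Lemma torus_powD (t : torus) (m n : degree) :
  torus_pow t (m `+` n)%mset = torus_pow t m * torus_pow t n.
Proof.
pose X := (finsupp m `|` finsupp n `|` finsupp (m `+` n)%mset)%fset.
have hm : (finsupp m `<=` X)%fset.
  by apply/fsubsetP => i hi; rewrite !inE hi.
have hn : (finsupp n `<=` X)%fset.
  by apply/fsubsetP => i hi; rewrite !inE hi orbT.
have hmn : (finsupp (m `+` n)%mset `<=` X)%fset.
  by apply/fsubsetP => i hi; rewrite !inE hi orbT.
rewrite (torus_pow_widen t hm) (torus_pow_widen t hn) (torus_pow_widen t hmn).
by rewrite -big_split /=; apply: eq_bigr => i _; rewrite msetE2 exprD.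
Qed.

Lemma torus_pow_norm (t : torus) (m : degree) : `|torus_pow t m| = 1.
Proof.
rewrite /torus_pow normr_prod big1 // => i _.
by rewrite normrX (svalP t) expr1n.
Qed.

Lemma torus_pow_conj (t : torus) (m : degree) :
  torus_pow t m * Num.conj (torus_pow t m) = 1.
Proof. by rewrite -normCK torus_pow_norm expr1n. Qed.

Lemma CK_family_torus (A : cstar_alg R) (s : mor L -> A) (t : torus) :
  CK_family s -> CK_family (fun f => torus_pow t (deg f) *: s f).
Proof.
move=> hs.
split.
- move=> f; rewrite cs_starZ !(cs_scalel, cs_scaler) !scalerA.
  by rewrite CK_partial_isometry // -mulrA torus_pow_conj mulr1.
- by move=> v; rewrite deg_idm torus_pow0 scale1r; exact: CK1_proj.
- by move=> v w vw; rewrite !deg_idm torus_pow0 !scale1r CK1_orth.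
- move=> f g fg; rewrite !(cs_scalel, cs_scaler) !scalerA CK2_comp //.
  by rewrite deg_comp // torus_powD.
- by move=> f g fg; rewrite !(cs_scalel, cs_scaler) CK2_zero // !scaler0.
- move=> f; rewrite cs_starZ !(cs_scalel, cs_scaler) !scalerA CK3 //.
  by rewrite deg_idm torus_pow0 torus_pow_conj.
- move=> v n; rewrite deg_idm torus_pow0 scale1r (CK4 hs v n).
  apply: eq_fsbigr => f _; rewrite cs_starZ !(cs_scalel, cs_scaler) !scalerA.
  by rewrite torus_pow_conj scale1r.
Qed.

Section GaugeAction.
Variables (A : cstar_alg R) (s : mor L -> A).
Hypothesis hA : is_graph_cstar s.

Lemma gauge_exists (t : torus) : exists alpha : A -> A,
  star_hom alpha /\ forall f, alpha (s f) = torus_pow t (deg f) *: s f.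
Proof. exact: (gc_univ hA (CK_family_torus t (gc_CK hA))). Qed.

(* The *-homomorphism alpha_t with alpha_t (s_f) = t^(deg f) s_f, given by the
   universal property; it is unique because s generates A. *)
Definition gauge (t : torus) : A -> A := sval (cid (gauge_exists t)).

Lemma gauge_star_hom (t : torus) : star_hom (gauge t).
Proof. by rewrite /gauge; case: cid => alpha []. Qed.

Lemma gaugeE (t : torus) f : gauge t (s f) = torus_pow t (deg f) *: s f.
Proof. by rewrite /gauge; case: cid => alpha []. Qed.

Definition gauge_invariant (J : set A) : Prop :=
  forall t : torus, gauge t @` J `<=` J.

Definition vertices_of (J : set A) : set (vertex L) :=
  [set v | J (s (idm v))].

Lemma vertices_of_hereditary (J : set A) :
  ideal J -> hereditary (vertices_of J).
Proof.
move=> [_ idJ] f; rewrite /vertices_of /= => Jr.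
rewrite -(CK3 (gc_CK hA)) -[in X in _ ** X](comp_idl f).
rewrite -(CK2_comp (gc_CK hA)) ?src_idm //.
by apply: (idJ _ _ _).1; apply: (idJ _ _ _).2.
Qed.

Lemma regular_ideal_hereditary (J : set A) :
  regular_ideal J -> hereditary (vertices_of J).
Proof. by case=> /vertices_of_hereditary. Qed.

End GaugeAction.
End GraphCstar.

(* Main.v *)
(* Let H be the set of vertices whose projection lies in J.  If every vertex
   outside H can reach a vertex w none of whose descendants lies in H, then the
   aperiodicity of L \ H at a vertex v follows by prepending a path from v to w
   to a witness of the aperiodicity of L at w.

   Otherwise some v outside H has all its descendants reaching H.  As J is its
   own double annihilator, it suffices that p_v a = a p_v = 0 for a in the
   annihilator of J; so let b = p_v b p_v be annihilated by J.  C*(L) acts on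
   l^2(X x Z^oo), where X is the set of infinite paths entering H and the second
   factor records degrees.  There b acts as 0, since s_f^* b = 0 whenever f ends
   in H.  The representation is isometric on the corner p_v C*(L) p_v:
   - it is contractive, by a Neumann series argument;
   - on the degree-0 part of the corner spanned by the s_f s_g^*, which is an
     increasing union of finite-dimensional algebras, |x^n| <= C |pi(x)^n| with
     C independent of n, and taking n = 2^j for self-adjoint x removes C;
   - a homogeneous component of an element has norm at most that of its image,
     and since x^n has polynomially many homogeneous components, the same power
     trick gives |x| <= |pi(x)| on the whole span. *)

Require Import Defs.
From HB Require Import structures.
From mathcomp Require Import all_boot all_order all_algebra.
From mathcomp Require Import finmap multiset complex.
From mathcomp Require Import all_classical all_reals all_analysis.
From mathcomp Require Import ring lra zify.
Set Implicit Arguments.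
Unset Strict Implicit.
Unset Printing Implicit Defensive.
Import Order.TTheory GRing.Theory Num.Theory.
Import numFieldNormedType.Exports.
Local Open Scope classical_set_scope.
Local Open Scope ring_scope.
Local Open Scope complex_scope.
Local Open Scope cstar_scope.

(** * The real Hilbert space l2(Z) *)

(** All norm estimates are drawn from the C*-identity alone: a self-adjoint x satisfies |x^(2^j)| =
    |x|^(2^j), so a bound on powers may lose any constant or polynomial factor. The relations do not
    say that distinct paths of equal degree have orthogonal range projections; this is extracted
    from CK4, using that the unit of a corner is an extreme point of its unit ball. The
    representation kills p_w whenever w cannot reach H, so faithfulness can hold only on suitable
    corners. At a vertex v as in the second case it holds because every s_f s_g^# with common source
    is detected: some path y entering H starts at that source, and s_f s_g^# carries the basis
    vector of gy to that of fy. The factor Z^oo plays the part of averaging over the torus: elements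
    of different degree move a vector of one grade into different grades, so a homogeneous component
    is cut out by restricting coordinates. Vanishing on the corner is enough: for a in the
    annihilator, (p_v a)(p_v a)^# lies both in the annihilator and in the corner. *)

Section UnorderedSum.
Variables (R : realType) (Z : choiceType).
Implicit Types (f g : Z -> R) (F : {fset Z}).

(** The index set used later, infinite paths times integer degrees, is uncountable, so a sum is the
    limit of the net of finite partial sums ordered by inclusion. *)
Definition has_sum f (l : R) := forall e, 0 < e ->
  exists F0 : {fset Z}, forall F, (F0 `<=` F)%fset ->
    `|\sum_(z <- F) f z - l| <= e.

Lemma has_sum_unique f l l' : has_sum f l -> has_sum f l' -> l = l'.
Proof.
move=> hl hl'; apply/eqP; rewrite -subr_eq0 -normr_eq0 eq_le normr_ge0 andbT.
apply/ler_addgt0Pl => e e0; rewrite addr0.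
have e2 : 0 < e / 2 by rewrite divr_gt0.
have [F1 h1] := hl _ e2; have [F2 h2] := hl' _ e2.
have {}h1 := h1 _ (fsubsetUl F1 F2); have {}h2 := h2 _ (fsubsetUr F1 F2).
move: h1 h2; set s := \sum_(z <- _) _ => h1 h2.
rewrite (splitr e) (_ : l - l' = (s - l') - (s - l)); last by ring.
by rewrite (le_trans (ler_normB _ _)) // lerD.
Qed.

Lemma has_sumD f g l k : has_sum f l -> has_sum g k -> has_sum (f \+ g) (l + k).
Proof.
move=> hl hl' e e0.
have e2 : 0 < e / 2 by rewrite divr_gt0.
have [F1 h1] := hl _ e2; have [F2 h2] := hl' _ e2.
exists (F1 `|` F2)%fset => F; rewrite fsubUset => /andP[/h1 {}h1 /h2 {}h2].
rewrite big_split /= [e]splitr opprD addrACA.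
by rewrite (le_trans (ler_normD _ _)) // lerD.
Qed.

Lemma has_sumZ a f l : has_sum f l -> has_sum (fun z => a * f z) (a * l).
Proof.
move=> hl e e0; have a1 : 0 < `|a| + 1 by rewrite ltr_wpDl.
have [F1 h1] := hl _ (divr_gt0 e0 a1); exists F1 => F /h1 {}h1.
rewrite -mulr_sumr -mulrBr normrM.
rewrite (le_trans (ler_wpM2l (normr_ge0 a) h1)) // mulrCA ger_pMr //.
by rewrite ler_pdivrMr // mul1r lerDl.
Qed.

Lemma has_sumN f l : has_sum f l -> has_sum (fun z => - f z) (- l).
Proof.
move=> /(has_sumZ (-1)); rewrite mulN1r.
by under eq_fun do rewrite mulN1r.
Qed.

Lemma has_sum_nonneg f M : (forall z, 0 <= f z) ->
  (forall F, \sum_(z <- F) f z <= M) ->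
  exists l, [/\ has_sum f l, l <= M & forall F, \sum_(z <- F) f z <= l].
Proof.
move=> f0 fM; pose S := [set \sum_(z <- F) f z | F in [set: {fset Z}]].
have S0 : has_sup S.
  split; first by exists (\sum_(z <- fset0) f z); exists fset0.
  by exists M => _ [F _ <-]; exact: fM.
have SF F : \sum_(z <- F) f z <= sup S.
  by apply: ub_le_sup; [case: S0 | exists F].
exists (sup S); split=> //.
  move=> e e0; have [_ [F0 _ <-] h0] := sup_adherent e0 S0.
  exists F0 => F F0F.
  have h1 : \sum_(z <- F0) f z <= \sum_(z <- F) f z.
    rewrite (big_fsetID _ (mem F0) F) /=.
    rewrite (_ : [fset x in F | x \in F0]%fset = F0).
      by rewrite lerDl sumr_ge0.
    apply/fsetP => z; rewrite !inE /= andb_idl //.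
    by move/(fsubsetP F0F).
  have := SF F; rewrite -subr_le0 => h2.
  by rewrite ler0_norm //; lra.
by apply: ge_sup; [case: S0 | move=> _ [F _ <-]; exact: fM].
Qed.

Lemma has_sum_ge0 f l : (forall z, 0 <= f z) -> has_sum f l ->
  forall F, \sum_(z <- F) f z <= l.
Proof.
move=> f0 hl F; apply/ler_addgt0Pl => e e0.
have [F0 h] := hl _ e0; have := h _ (fsubsetUl F0 F).
rewrite (big_fsetID _ (mem F)) /=.
rewrite (_ : [fset x in F0 `|` F | x \in F]%fset = F); last first.
  by apply/fsetP => z; rewrite !inE andb_idl // => ->; rewrite orbT.
set s := \sum_(z <- [fset _ | _ in _ & _]%fset) _.
have s0 : 0 <= s by apply: sumr_ge0.
rewrite ler_norml => /andP[_]; lra.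
Qed.

Definition sq_summable f := exists M, forall F, \sum_(z <- F) f z ^+ 2 <= M.

Lemma sq_summable_has_sum f : sq_summable f ->
  exists l, has_sum (fun z => f z ^+ 2) l.
Proof.
move=> [M /has_sum_nonneg]; case=> [z|l [hl _ _]]; first exact: sqr_ge0.
by exists l.
Qed.

Lemma sq_summable_comb a f g : sq_summable f -> sq_summable g ->
  sq_summable (fun z => a * f z + g z).
Proof.
move=> [M hM] [N hN]; exists (2 * a ^+ 2 * M + 2 * N) => F.
apply: (@le_trans _ _ (\sum_(z <- F) (2 * a ^+ 2 * f z ^+ 2 + 2 * g z ^+ 2))).
  apply: ler_sum => z _; rewrite -subr_ge0.
  by rewrite [leRHS](_ : _ = (a * f z - g z) ^+ 2) ?sqr_ge0 //; ring.
rewrite big_split /= -!mulr_sumr lerD // ler_wpM2l // mulr_ge0 //.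
exact: sqr_ge0.
Qed.

Lemma sq_summable_mul f g : sq_summable f -> sq_summable g ->
  exists l, has_sum (fun z => f z * g z) l.
Proof.
move=> hf hg.
have [p hp] := sq_summable_has_sum (sq_summable_comb 1 hf hg).
have [q hq] := sq_summable_has_sum (sq_summable_comb (-1) hf hg).
(* Polarisation: f g = ((f + g)^2 - (g - f)^2) / 4. *)
exists (4^-1 * (p + - q)).
rewrite (_ : (fun z => _) = fun z => 4^-1 *
    ((1 * f z + g z) ^+ 2 + - (-1 * f z + g z) ^+ 2)).
  exact: has_sumZ (has_sumD hp (has_sumN hq)).
by apply/funext => z; field.
Qed.

End UnorderedSum.

Section L2.
Variables (R : realType) (Z : choiceType).

Definition l2_pred : {pred Z -> R} := [pred f | `[< sq_summable f >]].

Lemma l2_submod : submod_closed l2_pred.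
Proof.
split=> [|a f g /asboolP hf /asboolP hg]; apply/asboolP; last first.
  exact: sq_summable_comb hf hg.
by exists 0 => F; rewrite big1 // => z _; rewrite expr0n.
Qed.

HB.instance Definition _ := GRing.isSubmodClosed.Build R (Z -> R) l2_pred l2_submod.

Record l2 := MkL2 { l2_fun :> Z -> R; l2P : l2_fun \in l2_pred }.
HB.instance Definition _ := [isSub for l2_fun].
HB.instance Definition _ := [Choice of l2 by <:].
HB.instance Definition _ := [SubChoice_isSubLmodule of l2 by <:].

Implicit Types (f g h : l2) (F : {fset Z}).

Lemma l2_sq f : sq_summable f.
Proof. by case: f => f /= /asboolP. Qed.

Lemma l2_ext f g : f =1 g -> f = g.
Proof. by move=> fg; apply/val_inj/funext. Qed.

Lemma l2D f g z : (f + g) z = f z + g z. Proof. by []. Qed.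
Lemma l2N f z : (- f) z = - f z. Proof. by []. Qed.
Lemma l2Z a f z : (a *: f) z = a * f z. Proof. by []. Qed.
Lemma l20 z : (0 : l2) z = 0. Proof. by []. Qed.

Definition ip f g : R := xget 0 [set l | has_sum (fun z => f z * g z) l].

Lemma ipP f g : has_sum (fun z => f z * g z) (ip f g).
Proof.
have [l hl] := sq_summable_mul (l2_sq f) (l2_sq g).
exact: (xgetI (P := [set l | has_sum (fun z => f z * g z) l]) 0 hl).
Qed.

Lemma ip_eq f g l : has_sum (fun z => f z * g z) l -> ip f g = l.
Proof. exact: has_sum_unique (ipP f g). Qed.

Lemma ipC f g : ip f g = ip g f.
Proof. by apply: ip_eq; under eq_fun do rewrite mulrC; exact: ipP. Qed.

Lemma ipDl f g h : ip (f + g) h = ip f h + ip g h.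
Proof.
apply: ip_eq; under eq_fun do rewrite l2D mulrDl.
exact: has_sumD (ipP _ _) (ipP _ _).
Qed.

Lemma ipZl a f g : ip (a *: f) g = a * ip f g.
Proof.
apply: ip_eq; under eq_fun do rewrite l2Z -mulrA.
exact: has_sumZ (ipP _ _).
Qed.

Lemma ipNl f g : ip (- f) g = - ip f g.
Proof. by rewrite -scaleN1r ipZl mulN1r. Qed.
Lemma ipBl f g h : ip (f - g) h = ip f h - ip g h.
Proof. by rewrite ipDl ipNl. Qed.
Lemma ipDr f g h : ip f (g + h) = ip f g + ip f h.
Proof. by rewrite ipC ipDl !(ipC f). Qed.
Lemma ipZr a f g : ip f (a *: g) = a * ip f g.
Proof. by rewrite ipC ipZl (ipC f). Qed.
Lemma ipNr f g : ip f (- g) = - ip f g.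
Proof. by rewrite ipC ipNl (ipC f). Qed.
Lemma ipBr f g h : ip f (g - h) = ip f g - ip f h.
Proof. by rewrite ipDr ipNr. Qed.

Lemma ip_sum f F : \sum_(z <- F) f z ^+ 2 <= ip f f.
Proof. by apply: has_sum_ge0 (ipP f f) F => z; rewrite sqr_ge0. Qed.

Lemma ip_ge0 f : 0 <= ip f f.
Proof. by have := ip_sum f fset0; rewrite big_seq_fset0. Qed.

Lemma ip_coord f z : f z ^+ 2 <= ip f f.
Proof. by have := ip_sum f [fset z]%fset; rewrite big_seq_fset1. Qed.

Lemma ip_le f M : (forall F, \sum_(z <- F) f z ^+ 2 <= M) -> ip f f <= M.
Proof.
move=> /has_sum_nonneg; case=> [z|l [hl lM _]]; first exact: sqr_ge0.
by rewrite (ip_eq hl).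
Qed.

Lemma ip_eq0 f : ip f f = 0 -> f = 0.
Proof.
move=> f0; apply: l2_ext => z; apply/eqP; rewrite l20 -sqrf_eq0 eq_le sqr_ge0.
by rewrite -f0 ip_coord.
Qed.

Definition l2n f := Num.sqrt (ip f f).

Lemma l2n_ge0 f : 0 <= l2n f. Proof. exact: sqrtr_ge0. Qed.
Lemma sqr_l2n f : l2n f ^+ 2 = ip f f. Proof. by rewrite sqr_sqrtr ?ip_ge0. Qed.
Lemma l2n_eq0 f : l2n f = 0 -> f = 0.
Proof. by move=> h; apply: ip_eq0; rewrite -sqr_l2n h expr0n. Qed.

Lemma l2nZ a f : l2n (a *: f) = `|a| * l2n f.
Proof. by rewrite /l2n ipZl ipZr mulrA -expr2 sqrtrM ?sqr_ge0 // sqrtr_sqr. Qed.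

Lemma l2nN f : l2n (- f) = l2n f.
Proof. by rewrite /l2n ipNl ipNr opprK. Qed.

(** Cauchy-Schwarz: the squared norm of <g,g> f - <f,g> g is <g,g> times the difference of the two
    sides, and it is nonnegative. *)
Lemma ip_sqr_le f g : ip f g ^+ 2 <= ip f f * ip g g.
Proof.
have [g0|g0] := eqVneq (ip g g) 0.
  by rewrite (ip_eq0 g0) -(scale0r 0) !ipZr !mul0r expr0n mulr0.
have gp : 0 < ip g g by rewrite lt_neqAle eq_sym g0 ip_ge0.
have := ip_ge0 (ip g g *: f - ip f g *: g).
rewrite ipBl !ipBr !ipZl !ipZr (ipC g f).
rewrite [X in 0 <= X](_ : _ = ip g g * (ip f f * ip g g - ip f g ^+ 2)); last by ring.
by rewrite pmulr_rge0 // subr_ge0.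
Qed.

Lemma ip_le_l2n f g : `|ip f g| <= l2n f * l2n g.
Proof.
rewrite -sqrtrM ?ip_ge0 // -sqrtr_sqr ler_wsqrtr //; exact: ip_sqr_le.
Qed.

Lemma l2nD f g : l2n (f + g) <= l2n f + l2n g.
Proof.
rewrite -(@ler_pXn2r _ 2) // ?nnegrE ?addr_ge0 ?l2n_ge0 // sqrrD !sqr_l2n.
rewrite ipDl !ipDr (ipC g f).
by have := le_trans (ler_norm _) (ip_le_l2n f g); lra.
Qed.

Lemma l2n_le f M : 0 <= M -> (forall F, \sum_(z <- F) f z ^+ 2 <= M ^+ 2) ->
  l2n f <= M.
Proof.
move=> M0 /ip_le h; rewrite -(@ler_pXn2r _ 2) // ?nnegrE ?l2n_ge0 //.
by rewrite sqr_l2n.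
Qed.

Lemma l2n_sum f F : \sum_(z <- F) f z ^+ 2 <= l2n f ^+ 2.
Proof. by rewrite sqr_l2n ip_sum. Qed.

Lemma l2n_coord f z : `|f z| <= l2n f.
Proof.
rewrite -(@ler_pXn2r _ 2) // ?nnegrE ?l2n_ge0 // real_normK ?num_real //.
by rewrite sqr_l2n ip_coord.
Qed.

Lemma l2n_ip f M : 0 <= M -> (forall g, ip f g <= M * l2n g) -> l2n f <= M.
Proof.
move=> M0 /(_ f); rewrite -sqr_l2n => h.
have [f0|f0] := eqVneq (l2n f) 0; first by rewrite f0.
by rewrite -(@ler_pM2r _ (l2n f)) ?lt_neqAle ?(eq_sym 0) ?f0 ?l2n_ge0 // -expr2.
Qed.

End L2.

(** * Bounded operators on l2(Y) *)

Section PartialInjection.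
Variables (R : realType) (Z : choiceType).

(** One equivalence says at once that [phi] is injective where it is defined and that [psi] is its
    inverse on the range. *)
Definition partial_inverse (phi psi : Z -> option Z) :=
  forall z w, phi z = Some w <-> psi w = Some z.

Lemma partial_inverse_sym phi psi :
  partial_inverse phi psi -> partial_inverse psi phi.
Proof. by move=> h z w; split=> /h. Qed.

Definition pull (phi : Z -> option Z) (f : Z -> R) z := oapp f 0 (phi z).

Lemma sum_pull phi psi (h : Z -> R) (s : seq Z) : partial_inverse phi psi ->
  uniq s ->
  \sum_(z <- s) pull phi h z = \sum_(w <- [fset x in pmap phi s]%fset) h w.
Proof.
move=> hphi us.
have -> : \sum_(z <- s) pull phi h z = \sum_(w <- pmap phi s) h w.
  elim: s {us} => [|z s IHs] /=; first by rewrite !big_nil.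
  rewrite big_cons IHs /pull; case: (phi z) => [w|] /=; rewrite ?add0r //.
  by rewrite big_cons.
apply: perm_big; apply: uniq_perm; rewrite ?fset_uniq //; last first.
  by move=> w; rewrite !inE.
elim: s us => [//|z s IHs] /= /andP[zs us].
case E: (phi z) => [w|] /=; last exact: IHs.
rewrite IHs // andbT; apply/negP; rewrite mem_pmap => /mapP[z' z's /esym E'].
by move: zs; have := (hphi _ _).1 E'; rewrite ((hphi _ _).1 E) => -[->]; rewrite z's.
Qed.

Lemma has_sum_pull phi psi (h : Z -> R) l : partial_inverse phi psi ->
  (forall w, psi w = None -> h w = 0) -> has_sum h l -> has_sum (pull phi h) l.
Proof.
move=> hphi h0 hl e e0; have [F0 hF] := hl _ e0.
(* A finite set containing the preimage of [F0] has an image covering [F0], except for points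
   outside the range of [phi], where [h] vanishes. *)
exists [fset x in pmap psi F0]%fset => G F0G.
rewrite (sum_pull _ hphi) ?fset_uniq //.
set A := [fset _ in _]%fset.
rewrite (big_fset_incl _ (fsubsetUl A F0)); first by apply: hF; exact: fsubsetUr.
move=> w; rewrite inE => /orP[-> //|wF0 wA]; apply: h0.
case E: (psi w) => [z|//]; case/negP: wA; rewrite inE mem_pmap.
have zG : z \in G.
  apply: (fsubsetP F0G); rewrite inE mem_pmap -E; exact: map_f.
by rewrite -((hphi z w).2 E); exact: map_f.
Qed.

Lemma sum_pull_sqr phi psi (f : l2 R Z) F : partial_inverse phi psi ->
  \sum_(z <- F : {fset Z}) pull phi f z ^+ 2 <= l2n f ^+ 2.
Proof.
move=> hphi; pose h w := f w ^+ 2.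
rewrite (eq_bigr (pull phi h)) => [|z _]; last first.
  by rewrite /pull; case: (phi z) => //=; rewrite expr0n.
by rewrite (sum_pull _ hphi) ?fset_uniq // l2n_sum.
Qed.

Lemma pull_l2 phi psi (f : l2 R Z) : partial_inverse phi psi ->
  pull phi f \in @l2_pred R Z.
Proof.
by move=> h; apply/asboolP; exists (l2n f ^+ 2) => F; exact: sum_pull_sqr h.
Qed.

End PartialInjection.

Section BoundedOperators.
Variables (R : realType) (Y : choiceType).
Local Notation Z := (Y * bool)%type.
Local Notation H := (l2 R Z).
Implicit Types (f g : H).

(* l^2(Y, C) is realised as the real space l^2(Y x {0,1}), with real parts at
   [false] and imaginary parts at [true]; [Jop] is multiplication by i. *)
Definition Jfun f (z : Z) : R := if z.2 then f (z.1, false) else - f (z.1, true).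

Let swap (z : Z) : option Z := Some (z.1, ~~ z.2).
Let swapP : partial_inverse swap swap.
Proof. by move=> [y b] [y' b']; split=> -[<- <-]; rewrite /swap /= negbK. Qed.

Lemma Jfun_l2 f : Jfun f \in @l2_pred R Z.
Proof.
apply/asboolP; exists (l2n f ^+ 2) => F.
apply: le_trans (sum_pull_sqr f F swapP); apply: ler_sum => -[y b] _.
by rewrite /Jfun /pull /=; case: b; rewrite ?sqrrN.
Qed.

Definition Jop f : H := MkL2 (Jfun_l2 f).

Lemma JopE f y b : Jop f (y, b) = if b then f (y, false) else - f (y, true).
Proof. by []. Qed.

Lemma Jop_linear : linear Jop.
Proof.
move=> a f g; apply: l2_ext => -[y b]; rewrite l2D l2Z !JopE !l2D !l2Z.
by case: b; rewrite // opprD mulrN.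
Qed.
HB.instance Definition _ := GRing.isLinear.Build R H H _ Jop Jop_linear.

Lemma JopD f g : Jop (f + g) = Jop f + Jop g. Proof. exact: linearD. Qed.
Lemma JopZ a f : Jop (a *: f) = a *: Jop f. Proof. exact: linearZ_LR. Qed.

Lemma JopK f : Jop (Jop f) = - f.
Proof. by apply: l2_ext => -[y b]; rewrite l2N !JopE; case: b. Qed.

Lemma ip_Jop f g : ip (Jop f) g = - ip f (Jop g).
Proof.
rewrite -ipNr; apply: ip_eq.
rewrite (_ : (fun z => _) = pull swap (fun z => f z * (- Jop g) z)).
  by apply: (has_sum_pull swapP) (ipP _ _).
apply/funext => -[y b]; change (Jop f (y, b) * g (y, b) =
  f (y, ~~ b) * - Jop g (y, ~~ b)); rewrite !JopE.
by case: b => /=; rewrite ?opprK // mulNr mulrN.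
Qed.

Lemma ip_JJ f g : ip (Jop f) (Jop g) = ip f g.
Proof. by rewrite ip_Jop JopK ipNr opprK. Qed.

Lemma ip_fJf f : ip f (Jop f) = 0.
Proof. by have := ip_Jop f f; rewrite ipC; lra. Qed.

Definition cscale (a : R[i]) f : H := complex.Re a *: f + complex.Im a *: Jop f.

Lemma l2n_cscale a f : (l2n (cscale a f))%:C = `|a| * (l2n f)%:C.
Proof.
rewrite normc_def -rmorphM /=; congr (_%:C).
rewrite /l2n -sqrtrM ?addr_ge0 ?sqr_ge0 //; congr Num.sqrt.
rewrite /cscale ipDl !ipDr !ipZl !ipZr ip_JJ (ipC (Jop f)) ip_fJf; ring.
Qed.

Definition adjoint_of (T S : H -> H) := forall f g, ip (T f) g = ip f (S g).

(** Real linearity is a consequence of having an adjoint ([adjoint_linear]); commuting with [Jop]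
    then makes the operator complex linear. *)
Definition is_bounded_op (T : H -> H) :=
  [/\ exists S, adjoint_of T S, forall f, T (Jop f) = Jop (T f) &
      exists M, forall f, l2n (T f) <= M * l2n f].

Lemma ip_ext f f' : (forall g, ip f g = ip f' g) -> f = f'.
Proof.
move=> h; apply/eqP; rewrite -subr_eq0; apply/eqP/ip_eq0.
by rewrite ipBl h subrr.
Qed.

Lemma adjoint_of_sym T S : adjoint_of T S -> adjoint_of S T.
Proof. by move=> h f g; rewrite ipC -h ipC. Qed.

Lemma adjoint_linear T S : adjoint_of T S -> linear T.
Proof.
by move=> h a f g; apply: ip_ext => k; rewrite h !(ipDl, ipZl) !h.
Qed.

Lemma adjoint_J T S : adjoint_of T S -> (forall f, T (Jop f) = Jop (T f)) ->
  forall f, S (Jop f) = Jop (S f).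
Proof.
move=> h hJ f; apply: ip_ext => k.
by rewrite ipC -h -[LHS]opprK -ip_Jop -hJ h ip_Jop opprK ipC.
Qed.

Lemma adjoint_bound T S M : adjoint_of T S -> 0 <= M ->
  (forall f, l2n (T f) <= M * l2n f) -> forall f, l2n (S f) <= M * l2n f.
Proof.
move=> h M0 hM f; apply: l2n_ip => [|g]; first by rewrite mulr_ge0 ?l2n_ge0.
rewrite ipC -h (le_trans (ler_norm _)) // (le_trans (ip_le_l2n _ _)) //.
by rewrite mulrAC ler_wpM2r ?l2n_ge0.
Qed.

Record bop := MkBop { bop_fun :> H -> H; bopP : `[< is_bounded_op bop_fun >] }.

HB.instance Definition _ := [isSub for bop_fun].
HB.instance Definition _ := [Choice of bop by <:].

Implicit Types (S T U : bop).

Lemma bop_ext S T : S =1 T -> S = T.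
Proof. by move=> h; apply/val_inj/funext. Qed.

Lemma bop_is T : is_bounded_op T. Proof. by case: T => /= ? /asboolP. Qed.
Lemma bop_J T f : T (Jop f) = Jop (T f). Proof. by case: (bop_is T). Qed.
Lemma bop_linear T : linear T.
Proof. by case: (bop_is T) => -[S /adjoint_linear]. Qed.
HB.instance Definition _ T := GRing.isLinear.Build R H H _ T (bop_linear T).

Lemma bop_cscale T a f : T (cscale a f) = cscale a (T f).
Proof. by rewrite /cscale -bop_J (linearD T) !(linearZ_LR T). Qed.

Lemma bop_bound T : exists2 M, 0 <= M & forall f, l2n (T f) <= M * l2n f.
Proof.
case: (bop_is T) => _ _ [M hM]; exists `|M| => // f.
by rewrite (le_trans (hM f)) // ler_wpM2r ?l2n_ge0 ?ler_norm.
Qed.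

Lemma bop_adj_subproof T : exists S : bop, adjoint_of T S.
Proof.
case: (bop_is T) => -[S h] hJ _; have [M M0 hM] := bop_bound T.
suff hS : `[< is_bounded_op S >] by exists (MkBop hS).
apply/asboolP; split; last by exists M; exact: adjoint_bound h M0 hM.
  by exists T; exact: adjoint_of_sym.
exact: adjoint_J h hJ.
Qed.

Definition bop_adj T : bop := sval (cid (bop_adj_subproof T)).

Lemma bop_adjP T f g : ip (T f) g = ip f (bop_adj T g).
Proof. by rewrite /bop_adj; case: cid => S /= ->. Qed.

Lemma bop_adj_eq T S : adjoint_of T S -> bop_adj T = S.
Proof.
move=> h; apply: bop_ext => f; apply: ip_ext => g.
by rewrite ipC -bop_adjP h ipC.
Qed.

Lemma bop_comb_subproof (a : R[i]) T U :
  `[< is_bounded_op (fun f => cscale a (T f) + U f) >].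
Proof.
apply/asboolP; split.
- exists (fun g => cscale a^* (bop_adj T g) + bop_adj U g) => f g.
  rewrite /cscale !ipDl !ipZl !ipDr !ipZr ip_Jop !bop_adjP -bop_J.
  by case: a => a b /=; rewrite mulrN mulNr (adjoint_J (bop_adjP T)) //; exact: bop_J.
- by move=> f; rewrite /cscale !bop_J !JopD !JopZ.
- have [M M0 hM] := bop_bound T; have [N N0 hN] := bop_bound U.
  exists (complex.Re `|a| * M + N) => f.
  rewrite (le_trans (l2nD _ _)) // mulrDl lerD //.
  have := l2n_cscale a (T f); rewrite normc_def -rmorphM => /complexI ->.
  by rewrite /= -mulrA ler_wpM2l ?sqrtr_ge0.
Qed.

(* The operations on operators are sealed behind opaque proofs, which keeps
   unification from unfolding them. *)
Lemma bop_comb_sig a T U : {V : bop | forall f, V f = cscale a (T f) + U f}.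
Proof. by exists (MkBop (bop_comb_subproof a T U)). Qed.
Definition bop_comb a T U : bop := sval (bop_comb_sig a T U).
Lemma bop_combE a T U f : bop_comb a T U f = cscale a (T f) + U f.
Proof. exact: svalP (bop_comb_sig a T U) f. Qed.

Lemma bop0_subproof : `[< is_bounded_op (fun _ => 0) >].
Proof.
apply/asboolP; split; first by exists (fun _ => 0) => f g; rewrite -(scale0r 0) ipZl ipZr !mul0r.
  by move=> f; rewrite linear0.
by exists 0 => f; rewrite mul0r -(scale0r 0) l2nZ normr0 mul0r.
Qed.
Lemma bop0_sig : {V : bop | forall f, V f = 0}.
Proof. by exists (MkBop bop0_subproof). Qed.
Definition bop0 : bop := sval bop0_sig.
Lemma bop0_apply f : bop0 f = 0.
Proof. exact: svalP bop0_sig f. Qed.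

Lemma bop_comp_subproof T U : `[< is_bounded_op (fun f => T (U f)) >].
Proof.
apply/asboolP; split.
- by exists (fun g => bop_adj U (bop_adj T g)) => f g; rewrite !bop_adjP.
- by move=> f; rewrite !bop_J.
- have [M M0 hM] := bop_bound T; have [N N0 hN] := bop_bound U.
  by exists (M * N) => f; rewrite (le_trans (hM _)) // -mulrA ler_wpM2l.
Qed.
Lemma bop_comp_sig T U : {V : bop | forall f, V f = T (U f)}.
Proof. by exists (MkBop (bop_comp_subproof T U)). Qed.
Definition bop_comp T U : bop := sval (bop_comp_sig T U).
Lemma bop_compE T U f : bop_comp T U f = T (U f).
Proof. exact: svalP (bop_comp_sig T U) f. Qed.

Definition bop_add T U := bop_comb 1 T U.
Definition bop_opp T := bop_comb (-1) T bop0.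
Definition bop_scale a T := bop_comb a T bop0.

Lemma cscale1 f : cscale 1 f = f.
Proof. by rewrite /cscale /= scale1r scale0r addr0. Qed.
Lemma cscaleN1 f : cscale (-1) f = - f.
Proof. by rewrite /cscale /= oppr0 scale0r addr0 scaleN1r. Qed.
Lemma cscaleD a f g : cscale a (f + g) = cscale a f + cscale a g.
Proof. by rewrite /cscale JopD !scalerDr addrACA. Qed.
Lemma cscaleDl a b f : cscale (a + b) f = cscale a f + cscale b f.
Proof. by case: a b => a a' [b b']; rewrite /cscale /= !scalerDl addrACA. Qed.
Lemma cscaleA a b f : cscale a (cscale b f) = cscale (a * b) f.
Proof.
case: a b => a a' [b b']; rewrite /cscale /= JopD !JopZ JopK.
rewrite !scalerDr !scalerA scalerN !scalerDl scaleNr.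
by rewrite -!addrA; congr (_ + _); rewrite addrA addrC.
Qed.

Lemma bop_addE T U f : bop_add T U f = T f + U f.
Proof. by rewrite bop_combE cscale1. Qed.
Lemma bop_oppE T f : bop_opp T f = - T f.
Proof. by rewrite bop_combE cscaleN1 bop0_apply addr0. Qed.
Lemma bop_scaleE a T f : bop_scale a T f = cscale a (T f).
Proof. by rewrite bop_combE bop0_apply addr0. Qed.

Lemma bop_addA : associative bop_add.
Proof. by move=> T U V; apply: bop_ext => f; rewrite !bop_addE addrA. Qed.
Lemma bop_addC : commutative bop_add.
Proof. by move=> T U; apply: bop_ext => f; rewrite !bop_addE addrC. Qed.
Lemma bop_add0 : left_id bop0 bop_add.
Proof. by move=> T; apply: bop_ext => f; rewrite bop_addE bop0_apply add0r. Qed.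
Lemma bop_addN : left_inverse bop0 bop_opp bop_add.
Proof. by move=> T; apply: bop_ext => f; rewrite bop_addE bop_oppE bop0_apply addNr. Qed.
HB.instance Definition _ :=
  GRing.isZmodule.Build bop bop_addA bop_addC bop_add0 bop_addN.

Lemma bopD T U f : (T + U) f = T f + U f. Proof. exact: bop_addE. Qed.
Lemma bopN T f : (- T) f = - T f. Proof. exact: bop_oppE. Qed.
Lemma bop0E f : (0 : bop) f = 0. Proof. exact: bop0_apply. Qed.

Lemma bop_scaleA a b T : bop_scale a (bop_scale b T) = bop_scale (a * b) T.
Proof. by apply: bop_ext => f; rewrite !bop_scaleE cscaleA. Qed.
Lemma bop_scale1 : left_id 1 bop_scale.
Proof. by move=> T; apply: bop_ext => f; rewrite bop_scaleE cscale1. Qed.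
Lemma bop_scaleDr : right_distributive bop_scale +%R.
Proof.
by move=> a T U; apply: bop_ext => f; rewrite bopD !bop_scaleE bopD cscaleD.
Qed.
Lemma bop_scaleDl T : {morph bop_scale^~ T : a b / a + b}.
Proof.
by move=> a b; apply: bop_ext => f; rewrite bopD !bop_scaleE cscaleDl.
Qed.
HB.instance Definition _ := GRing.Zmodule_isLmodule.Build R[i] bop
  bop_scaleA bop_scale1 bop_scaleDr bop_scaleDl.

Lemma bopZ a T f : (a *: T) f = cscale a (T f). Proof. exact: bop_scaleE. Qed.

(** The infimum of the admissible constants is itself admissible, since for nonzero f the ratio of
    the norms of T f and f is a lower bound of all of them. *)
Lemma opn_sig T : {N : R | [/\ 0 <= N, forall f, l2n (T f) <= N * l2n f &
  forall M, 0 <= M -> (forall f, l2n (T f) <= M * l2n f) -> N <= M]}.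
Proof.
pose E : set R := [set M | 0 <= M /\ forall f, l2n (T f) <= M * l2n f].
have E0 : E !=set0 by have [M M0 hM] := bop_bound T; exists M.
exists (inf E); split=> [|f|M M0 hM].
- by apply: lb_le_inf => // M [].
- have [f0|f0] := eqVneq (l2n f) 0.
    by rewrite (l2n_eq0 f0) linear0 -(scale0r 0) l2nZ normr0 !mul0r mulr0.
  have fp : 0 < l2n f by rewrite lt_neqAle eq_sym f0 l2n_ge0.
  rewrite -ler_pdivrMr //; apply: lb_le_inf => // M [_ hM].
  by rewrite ler_pdivrMr.
- by apply: ge_inf; [exists 0 => ? [] | split].
Qed.
Definition opn T : R := sval (opn_sig T).

Lemma opn_ge0 T : 0 <= opn T.
Proof. by have [] := svalP (opn_sig T). Qed.

Lemma opnP T f : l2n (T f) <= opn T * l2n f.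
Proof. by have [] := svalP (opn_sig T). Qed.

Lemma opn_le T M : 0 <= M -> (forall f, l2n (T f) <= M * l2n f) -> opn T <= M.
Proof. by have [_ _] := svalP (opn_sig T); apply. Qed.

Lemma opnD T U : opn (T + U) <= opn T + opn U.
Proof.
apply: opn_le => [|f]; first by rewrite addr_ge0 ?opn_ge0.
by rewrite bopD (le_trans (l2nD _ _)) // mulrDl lerD ?opnP.
Qed.

Lemma l2n_cscaleE a f : l2n (cscale a f) = complex.Re `|a| * l2n f.
Proof.
by have := l2n_cscale a f; rewrite normc_def -rmorphM => /complexI ->.
Qed.

Lemma Re_norm_ge0 (a : R[i]) : 0 <= complex.Re `|a|.
Proof. by rewrite normc_def /= sqrtr_ge0. Qed.

Lemma opnN T : opn (- T) = opn T.
Proof.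
apply/eqP; rewrite eq_le; apply/andP; split; apply: opn_le (opn_ge0 _) _ => f.
  by rewrite bopN l2nN opnP.
by rewrite -l2nN -bopN opnP.
Qed.

Lemma opnZ a T : opn (a *: T) = complex.Re `|a| * opn T.
Proof.
apply/eqP; rewrite eq_le; apply/andP; split.
  apply: opn_le => [|f]; first by rewrite mulr_ge0 ?opn_ge0 ?Re_norm_ge0.
  by rewrite bopZ l2n_cscaleE -mulrA ler_wpM2l ?opnP ?Re_norm_ge0.
have [a0|a0] := eqVneq (complex.Re `|a|) 0; first by rewrite a0 mul0r opn_ge0.
have ap : 0 < complex.Re `|a| by rewrite lt_neqAle eq_sym a0 Re_norm_ge0.
rewrite mulrC -ler_pdivlMr //; apply: opn_le => [|f].
  by rewrite divr_ge0 ?opn_ge0 ?Re_norm_ge0.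
rewrite mulrAC ler_pdivlMr // mulrC -l2n_cscaleE -bopZ; exact: opnP.
Qed.

Lemma opn_eq0 T : opn T = 0 -> T = 0.
Proof.
move=> h; apply: bop_ext => f; rewrite bop0E; apply: l2n_eq0; apply/eqP.
by rewrite eq_le l2n_ge0 -(mul0r (l2n f)) -h opnP.
Qed.

Definition bop_norm T : R[i] := (opn T)%:C.

Lemma bop_normD T U : bop_norm (T + U) <= bop_norm T + bop_norm U.
Proof. by rewrite /bop_norm -rmorphD lecR opnD. Qed.
Lemma bop_normZ (a : R[i]) T : bop_norm (a *: T) = `|a| * bop_norm T.
Proof. by rewrite /bop_norm opnZ rmorphM normc_def. Qed.
Lemma bop_norm_eq0 T : bop_norm T = 0 -> T = 0.
Proof. by move=> /complexI/opn_eq0. Qed.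

HB.instance Definition _ := Lmodule_isNormed.Build R[i] bop
  bop_normD bop_normZ bop_norm_eq0.

Lemma bop_normE T : `|T| = (opn T)%:C. Proof. by []. Qed.

End BoundedOperators.

(** * The C*-algebra of bounded operators *)

Section OperatorCstar.
Variables (R : realType) (Y : choiceType).
Local Notation Z := (Y * bool)%type.
Local Notation H := (l2 R Z).
Local Notation B := (bop R Y).
Implicit Types (f g : H) (S T U : B).

Lemma opn_adj_le T : opn (bop_adj T) <= opn T.
Proof.
apply: opn_le (opn_ge0 T) _; apply: adjoint_bound (bop_adjP T) (opn_ge0 T) _.
exact: opnP.
Qed.

Lemma bop_adjD T U : bop_adj (T + U) = bop_adj T + bop_adj U.
Proof.
by apply: bop_adj_eq => f g; rewrite !bopD ipDl ipDr !bop_adjP.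
Qed.

Lemma bop_adjN T : bop_adj (- T) = - bop_adj T.
Proof. by apply: bop_adj_eq => f g; rewrite !bopN ipNl ipNr bop_adjP. Qed.

Lemma bop_adjK T : bop_adj (bop_adj T) = T.
Proof. by apply: bop_adj_eq => f g; rewrite ipC -bop_adjP ipC. Qed.

Lemma bop_adjZ (a : R[i]) T : bop_adj (a *: T) = (Num.conj a) *: bop_adj T.
Proof.
apply: bop_adj_eq => f g; rewrite !bopZ /cscale ipDl ipDr !ipZl !ipZr ip_Jop.
by rewrite !bop_adjP bop_J; case: a => a b /=; rewrite mulrN mulNr.
Qed.

Lemma bop_adjM T U : bop_adj (bop_comp T U) = bop_comp (bop_adj U) (bop_adj T).
Proof. by apply: bop_adj_eq => f g; rewrite !bop_compE !bop_adjP. Qed.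

Lemma opnM T U : opn (bop_comp T U) <= opn T * opn U.
Proof.
apply: opn_le => [|f]; first by rewrite mulr_ge0 ?opn_ge0.
by rewrite bop_compE (le_trans (opnP T (U f))) // -mulrA ler_wpM2l ?opn_ge0 ?opnP.
Qed.

(** The nontrivial inequality is |T f|^2 = <f, T^# T f> <= |T^# T| |f|^2. *)
Lemma opn_adjM T : opn (bop_comp (bop_adj T) T) = opn T ^+ 2.
Proof.
apply/eqP; rewrite eq_le; apply/andP; split.
  by rewrite (le_trans (opnM _ _)) // expr2 ler_wpM2r ?opn_ge0 ?opn_adj_le.
set V := bop_comp _ _; rewrite -[leRHS]sqr_sqrtr ?opn_ge0 //.
rewrite ler_pXn2r ?nnegrE ?opn_ge0 ?sqrtr_ge0 //.
apply: opn_le => [|f]; first exact: sqrtr_ge0.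
rewrite -(@ler_pXn2r _ 2) // ?nnegrE ?mulr_ge0 ?l2n_ge0 ?sqrtr_ge0 //.
rewrite exprMn (sqr_sqrtr (opn_ge0 V)) (sqr_l2n (T f)) bop_adjP -bop_compE.
rewrite (le_trans (ler_norm _)) // (le_trans (ip_le_l2n _ _)) //.
by rewrite mulrC expr2 mulrA ler_wpM2r ?l2n_ge0 // (opnP V).
Qed.

Section Completeness.
Variables (F : set_system B) (FF : ProperFilter F).

(** The limit is taken coordinate by coordinate. The Cauchy bound holds for every finite sum of
    squared coordinates, passes to the limit there, and only then is extended to the whole norm. No
    adjoint is claimed, so that the lemma can be applied a second time, to the filter of
    adjoints. *)
Lemma pointwise_limit :
  (forall e, 0 < e -> exists T0, F [set T : B | opn (T0 - T) <= e]) ->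
  exists L : H -> H, (forall f, L (Jop f) = Jop (L f)) /\
    forall e, 0 < e -> F [set T : B | forall f, l2n (L f - T f) <= e * l2n f].
Proof.
move=> hF; pose l f z := lim ((fun T : B => T f z) @ F).
have hl f z : (fun T : B => T f z) @ F --> l f z.
  apply: cauchy_cvg; apply: cauchy_exP => e e0.
  have n0 : 0 < l2n f + 1 by rewrite ltr_wpDl ?l2n_ge0.
  have [T0 hT0] := hF _ (divr_gt0 e0 n0); exists (T0 f z).
  change (F [set T : B | ball (T0 f z) e (T f z)]).
  apply: filterS hT0 => T /= hT; rewrite -ball_normE /=.
  rewrite (_ : T0 f z - T f z = (T0 - T) f z); last by rewrite bopD bopN.
  rewrite (le_lt_trans (l2n_coord _ _)) // (le_lt_trans (opnP _ _)) //.
  rewrite (le_lt_trans (ler_wpM2r (l2n_ge0 f) hT)) //.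
  by rewrite mulrAC ltr_pdivrMr // ltr_pM2l // ltrDl.
have key e : 0 < e -> F [set T : B | forall f (A : {fset Z}),
    \sum_(z <- A) (l f z - T f z) ^+ 2 <= (e * l2n f) ^+ 2].
  move=> e0; have e2 : 0 < e / 2 by rewrite divr_gt0.
  have [T0 hT0] := hF _ e2.
  apply: (filterS _ hT0) => T hT f A.
  have cv (s : seq Z) : (fun T' : B => \sum_(z <- s) (T' f z - T f z) ^+ 2) @ F -->
      \sum_(z <- s) (l f z - T f z) ^+ 2.
    elim: s => [|z s IHs].
      rewrite big_nil; under eq_fun do rewrite big_nil; exact: cvg_cst.
    rewrite big_cons; under eq_fun do rewrite big_cons.
    apply: cvgD IHs; rewrite expr2; under eq_fun do rewrite expr2.
    by apply: cvgM; apply: cvgB => //; exact: cvg_cst.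
  apply: cvgr_to_le (cv A) _; apply: (filterS _ hT0) => T' hT'.
  rewrite (eq_bigr (fun z => (T' - T) f z ^+ 2)) => [|z _]; last first.
    by rewrite bopD bopN.
  rewrite (le_trans (l2n_sum _ _)) // ler_pXn2r ?nnegrE ?mulr_ge0 ?l2n_ge0 ?(ltW e0) //.
  rewrite (le_trans (opnP _ _)) // ler_wpM2r ?l2n_ge0 //.
  have hD := opnD (T0 - T) (- (T0 - T')); rewrite opnN in hD.
  have E : T' - T = (T0 - T) + - (T0 - T') by rewrite opprB [RHS]addrC addrA subrK.
  rewrite E; apply: (le_trans hD); rewrite (splitr e); exact: lerD.
have ll2 f : l f \in @l2_pred R Z.
  have [T hT] := filter_ex (key _ ltr01).
  have h1 : sq_summable (fun z => l f z - T f z) by eexists; exact: hT.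
  apply/asboolP; have := sq_summable_comb 1 h1 (l2_sq (T f)).
  by congr sq_summable; apply/funext => z; rewrite mul1r subrK.
exists (fun f => MkL2 (ll2 f)); split=> [f|e e0].
  apply: l2_ext => -[y b]; rewrite JopE /=.
  have h2 : (fun T : B => T (Jop f) (y, b)) @ F -->
      (if b then l f (y, false) else - l f (y, true)).
    rewrite (_ : (fun T : B => _) =
      fun T : B => if b then T f (y, false) else - T f (y, true)).
      by case: (b); [exact: hl | apply: cvgN; exact: hl].
    by apply/funext => T; rewrite bop_J.
  exact: cvg_unique (hl (Jop f) (y, b)) h2.
apply: (filterS _ (key _ e0)) => T hT f.
by apply: l2n_le => [|A]; [rewrite mulr_ge0 ?l2n_ge0 ?(ltW e0) | exact: hT].
Qed.

End Completeness.

(** Membership in [bop] demands an adjoint of the limit. Taking adjoints does not increase the norm,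
    so the adjoints also form a Cauchy filter, and its limit is the required adjoint. *)
Lemma bop_complete (F : set_system B) : ProperFilter F -> cauchy F -> cvg F.
Proof.
move=> FF /cauchyP cF.
have hF e : 0 < e -> exists T0, F [set T : B | opn (T0 - T) <= e].
  move=> e0; have [|T0 hT0] := cF e%:C; first by rewrite ltcR.
  exists T0; apply: filterS hT0 => T.
  by rewrite -ball_normE /= bop_normE ltcR => /ltW.
have hG e : 0 < e -> exists T0, (@bop_adj R Y @ F) [set T : B | opn (T0 - T) <= e].
  move=> /hF[T0 hT0]; exists (bop_adj T0).
  change (F [set T : B | opn (bop_adj T0 - bop_adj T) <= e]).
  apply: (filterS _ hT0) => T hT; rewrite /= in hT; rewrite /= -bop_adjN -bop_adjD.
  exact: le_trans (opn_adj_le _) hT.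
have [L [LJ hL]] := pointwise_limit FF hF.
have [M [MJ hM]] := pointwise_limit (fmap_proper_filter _ FF) hG.
have adjLM : adjoint_of L M.
  move=> f g; apply/eqP; rewrite -subr_eq0 -normr_eq0 eq_le normr_ge0 andbT.
  apply/ler_addgt0Pl => e e0; rewrite addr0.
  set c := 2 * (l2n f * l2n g) + 1.
  have c0 : 0 < c by rewrite ltr_wpDl // !mulr_ge0 ?l2n_ge0.
  have ec : 0 < e / c by rewrite divr_gt0.
  have hM' : F [set T : B | forall k, l2n (M k - bop_adj T k) <= e / c * l2n k].
    exact: hM ec.
  have [T [hT hS]] := filter_ex (filterI (hL _ ec) hM').
  have -> : ip (L f) g - ip f (M g) =
      ip (L f - T f) g - ip f (M g - bop_adj T g).
    by rewrite ipBl ipBr bop_adjP; ring.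
  rewrite (le_trans (ler_normB _ _)) //.
  have h1 : `|ip (L f - T f) g| <= e / c * l2n f * l2n g.
    by rewrite (le_trans (ip_le_l2n _ _)) // ler_wpM2r ?l2n_ge0.
  have h2 : `|ip f (M g - bop_adj T g)| <= l2n f * (e / c * l2n g).
    by rewrite (le_trans (ip_le_l2n _ _)) // ler_wpM2l ?l2n_ge0 //; exact: hS.
  rewrite (le_trans (lerD h1 h2)) //.
  rewrite [leLHS](_ : _ = e / c * (2 * (l2n f * l2n g))); last by ring.
  by rewrite mulrAC ler_pdivrMr // ler_pM2l // lerDl.
have bL : `[< is_bounded_op L >].
  apply/asboolP; split=> //; first by exists M.
  have [T hT] := filter_ex (hL _ ltr01); exists (1 + opn T) => f.
  rewrite -[L f](subrK (T f)) (le_trans (l2nD _ _)) // mulrDl lerD //.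
  exact: opnP.
apply/cvg_ex; exists (MkBop bL); apply/cvg_ballP => e e0.
have [r r0 ->] : exists2 r : R, 0 < r & e = r%:C.
  exists (complex.Re e); first by move: e0; rewrite ltcE => /andP[].
  by rewrite RRe_real // gtr0_real.
have r2 : 0 < r / 2 by rewrite divr_gt0.
apply: filterS (hL _ r2) => T hT; rewrite -ball_normE /= bop_normE ltcR.
apply: (@le_lt_trans _ _ (r / 2)); last by rewrite ltr_pdivrMr // ltr_pMr // ltr1n.
by apply: opn_le => [|f]; [exact: ltW | rewrite bopD bopN; exact: hT].
Qed.

HB.instance Definition _ := Uniform_isComplete.Build B bop_complete.

Definition bop_cstar : cstar_alg R.
Proof.
refine (@MkCstarAlg R B (@bop_comp R Y) (@bop_adj R Y)
  _ _ _ _ _ _ _ _ _ _ _).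
- by move=> S T U; apply: bop_ext => f; rewrite !bop_compE.
- by move=> S T U; apply: bop_ext => f; rewrite !(bopD, bop_compE).
- by move=> S T U; apply: bop_ext => f; rewrite !(bopD, bop_compE) linearD.
- by move=> a S T; apply: bop_ext => f; rewrite !(bopZ, bop_compE).
- move=> a S T; apply: bop_ext => f; by rewrite !(bopZ, bop_compE) bop_cscale.
- by move=> S T; rewrite !bop_normE -rmorphM lecR opnM.
- exact: bop_adjK.
- exact: bop_adjD.
- exact: bop_adjZ.
- exact: bop_adjM.
- by move=> T; rewrite !bop_normE -rmorphXn opn_adjM.
Defined.

End OperatorCstar.

(** * Infinite paths *)

Section Factorizations.
Variable L : Ngraph.
Implicit Types (f g h : mor L) (m n : degree).

Lemma msetDBK m n : (m `<=` n)%mset -> (m `+` (n `\` m))%mset = n.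
Proof. by move=> /msubsetP mn; apply/msetP => i; rewrite !msetE2 subnKC. Qed.

Lemma msubset_addr m n : (m `<=` m `+` n)%mset.
Proof. by apply/msubsetP => i; rewrite msetE2 leq_addr. Qed.

Lemma msubset_addl m n : (m `<=` n `+` m)%mset.
Proof. by apply/msubsetP => i; rewrite msetE2 leq_addl. Qed.

Lemma mcomp_inj g h g' h' : src g = rng h -> src g' = rng h' ->
  mcomp g h = mcomp g' h' -> deg g = deg g' -> g = g' /\ h = h'.
Proof.
move=> gh gh' e dg.
have dh : deg h = deg h'.
  apply: (can_inj (msetDKB (deg g))).
  by rewrite -deg_comp // e deg_comp // dg.
have [[a b] [_ u]] := factorization (deg_comp gh).
have e1 : (a, b) = (g, h) by apply: u.
have e2 : (a, b) = (g', h') by apply: u.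
by move: e1; rewrite e2 => -[].
Qed.

Definition split_at f m : mor L * mor L := xget (f, f)
  [set gh | [/\ src gh.1 = rng gh.2, f = mcomp gh.1 gh.2 & deg gh.1 = m]].
Definition init f m := (split_at f m).1.
Definition rest f m := (split_at f m).2.

Lemma split_atP f m : (m `<=` deg f)%mset ->
  [/\ src (init f m) = rng (rest f m), f = mcomp (init f m) (rest f m) &
      deg (init f m) = m].
Proof.
move=> /msetDBK/esym/factorization [gh [[h1 h2 h3 _] _]].
exact: (@xgetI _ (f, f) [set gh | [/\ src gh.1 = rng gh.2,
  f = mcomp gh.1 gh.2 & deg gh.1 = m]] gh (And3 h1 h2 h3)).
Qed.

Lemma init_comp g h : src g = rng h -> init (mcomp g h) (deg g) = g.
Proof.
move=> gh; have [|h1 h2 h3] := @split_atP (mcomp g h) (deg g).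
  by rewrite deg_comp // msubset_addr.
by have [] := mcomp_inj gh h1 h2 (esym h3).
Qed.

Lemma rest_comp g h : src g = rng h -> rest (mcomp g h) (deg g) = h.
Proof.
move=> gh; have [|h1 h2 h3] := @split_atP (mcomp g h) (deg g).
  by rewrite deg_comp // msubset_addr.
by have [] := mcomp_inj gh h1 h2 (esym h3).
Qed.

Lemma init_id f : init f (deg f) = f.
Proof. by rewrite -{1}(comp_idr f) init_comp // rng_idm. Qed.

Lemma init_compl g h n : src g = rng h -> (n `<=` deg g)%mset ->
  init (mcomp g h) n = init g n.
Proof.
move=> gh /split_atP [h1 h2 h3].
have h4 : src (rest g n) = rng h by rewrite -(src_comp h1) -h2.
have -> : mcomp g h = mcomp (init g n) (mcomp (rest g n) h).
  by rewrite Defs.compA // -h2.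
by have := @init_comp (init g n) (mcomp (rest g n) h); rewrite h3 => ->; rewrite ?rng_comp.
Qed.

Lemma init_init f m n : (m `<=` n)%mset -> (n `<=` deg f)%mset ->
  init (init f n) m = init f m.
Proof.
by move=> mn /split_atP[h1 h2 h3]; rewrite {2}h2 init_compl // h3.
Qed.

Lemma deg0_idm f : deg f = mset0 -> f = idm (rng f).
Proof.
move=> df; have [] := @mcomp_inj (idm (rng f)) f f (idm (src f)).
- by rewrite src_idm.
- by rewrite rng_idm.
- by rewrite comp_idl comp_idr.
- by rewrite deg_idm df.
- by move=> /esym.
Qed.

End Factorizations.

Section InfinitePaths.
Variable L : Ngraph.
Implicit Types (f g h : mor L) (m n : degree) (x : degree -> mor L).

(* An infinite path is given by its initial segments of every degree. *)
Definition is_ipath x := (forall n, deg (x n) = n) /\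
  forall m n, (m `<=` n)%mset ->
    exists2 g, src (x m) = rng g & x n = mcomp (x m) g.

Definition shift m x n := rest (x (m `+` n)%mset) m.
(** The composite has degree deg f + n, longer than needed, so its initial segment of degree n
    exists without any comparison of n with deg f. *)
Definition prepend f x n := init (mcomp f (x n)) n.

Lemma shiftP m x n : is_ipath x ->
  [/\ src (x m) = rng (shift m x n), deg (shift m x n) = n &
      x (m `+` n)%mset = mcomp (x m) (shift m x n)].
Proof.
move=> [dx hx]; have [g h1 h2] := hx _ _ (msubset_addr m n).
have -> : shift m x n = g by rewrite /shift h2 -{2}(dx m) rest_comp.
split=> //; apply: (can_inj (msetDKB m)).
by rewrite -{1}(dx m) -deg_comp // -h2 dx.
Qed.

Lemma ipath0 x : is_ipath x -> x mset0 = idm (rng (x mset0)).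
Proof. by move=> [dx _]; apply: deg0_idm; rewrite dx. Qed.

Lemma rng_ipath x n : is_ipath x -> rng (x n) = rng (x mset0).
Proof.
move=> hx; have [h1 _ h2] := shiftP mset0 n hx.
by rewrite -[n]mset0D h2 rng_comp.
Qed.

Lemma init_ipath x m n : is_ipath x -> (m `<=` n)%mset -> init (x n) m = x m.
Proof. by move=> [dx hx] /hx[g h1 ->]; rewrite -{2}(dx m) init_comp. Qed.

Lemma rng_shift m x : is_ipath x -> rng (shift m x mset0) = src (x m).
Proof. by move=> /(shiftP m mset0)[-> _ _]. Qed.

Lemma src_shift m x n : is_ipath x -> src (shift m x n) = src (x (m `+` n)%mset).
Proof. by move=> /(shiftP m n)[h _ ->]; rewrite src_comp. Qed.

Lemma shift_ipath m x : is_ipath x -> is_ipath (shift m x).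
Proof.
move=> hx; split=> [n|n n' nn']; first by have [] := shiftP m n hx.
have [a1 a2 a3] := shiftP m n hx; have [b1 b2 b3] := shiftP m n' hx.
have [|g c1 c2] := hx.2 (m `+` n)%mset (m `+` n')%mset; first exact: msetDS.
exists g; first by rewrite src_shift.
move: c2; rewrite b3 a3 -Defs.compA //; last by rewrite src_shift.
move=> /mcomp_inj[] //; rewrite rng_comp //.
by rewrite src_shift.
Qed.

Lemma ipath_eq_comp x f g : is_ipath x -> src f = rng g ->
  (x (deg (mcomp f g)) = mcomp f g <->
   x (deg f) = f /\ shift (deg f) x (deg g) = g).
Proof.
move=> hx fg; rewrite deg_comp //.
have [a1 a2 a3] := shiftP (deg f) (deg g) hx.
split=> [e|[h1 h2]]; last by rewrite a3 h2 h1.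
by have [] := mcomp_inj a1 fg (etrans (esym a3) e) (hx.1 _).
Qed.

Lemma shiftD m n x : is_ipath x -> shift (m `+` n)%mset x = shift n (shift m x).
Proof.
move=> hx; apply/funext => k.
have hs := shift_ipath m hx.
have [a1 a2 a3] := shiftP (m `+` n)%mset k hx.
have [b1 b2 b3] := shiftP n k hs; have [c1 c2 c3] := shiftP m n hx.
have [d1 d2 d3] := shiftP m (n `+` k)%mset hx.
have e : mcomp (x (m `+` n)%mset) (shift (m `+` n)%mset x k) =
    mcomp (x (m `+` n)%mset) (shift n (shift m x) k).
  rewrite -a3 -msetDA d3 b3 Defs.compA ?c3 //.
by have [] := mcomp_inj a1 _ e erefl; rewrite // c3 src_comp.
Qed.

Section Prepend.
Variables (f : mor L) (x : degree -> mor L).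
Hypotheses (hx : is_ipath x) (fx : rng (x mset0) = src f).

Let fx' n : src f = rng (x n). Proof. by rewrite rng_ipath. Qed.

Let deg_fx n : deg (mcomp f (x n)) = (deg f `+` n)%mset.
Proof. by rewrite deg_comp // hx.1. Qed.

Let init_fx m n : (m `<=` n)%mset -> init (mcomp f (x n)) m = prepend f x m.
Proof.
move=> mn; have [g h1 h2] := hx.2 _ _ mn.
rewrite h2 Defs.compA // init_compl ?src_comp //.
by rewrite deg_fx msubset_addl.
Qed.

Lemma prepend_ipath : is_ipath (prepend f x).
Proof.
have hn n : (n `<=` deg (mcomp f (x n)))%mset by rewrite deg_fx msubset_addl.
split=> [n|m n mn]; first by have [] := split_atP (hn n).
have hmn : (m `<=` deg (prepend f x n))%mset by have [_ _ ->] := split_atP (hn n).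
have [h1 h2 h3] := split_atP hmn.
have e : init (prepend f x n) m = prepend f x m by rewrite init_init // init_fx.
by exists (rest (prepend f x n) m); rewrite -e.
Qed.

Lemma prependE n : prepend f x (deg f `+` n)%mset = mcomp f (x n).
Proof.
rewrite /prepend; have [g h1 ->] := hx.2 _ _ (msubset_addl n (deg f)).
by rewrite Defs.compA // -deg_fx init_comp // src_comp.
Qed.

Lemma prepend_init : prepend f x (deg f) = f.
Proof. by rewrite -[deg f]msetD0 prependE ipath0 // fx comp_idr. Qed.

Lemma shift_prepend : shift (deg f) (prepend f x) = x.
Proof.
apply/funext => n; have [h1 h2 h3] := shiftP (deg f) n prepend_ipath.
rewrite prependE in h3.
have [] := mcomp_inj (fx' n) h1 h3 _; last by [].
by rewrite prepend_init.
Qed.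

End Prepend.

Lemma prepend_shift m x : is_ipath x -> prepend (x m) (shift m x) = x.
Proof.
move=> hx; apply/funext => n; rewrite /prepend.
have [_ _ <-] := shiftP m n hx.
by rewrite init_ipath // msubset_addl.
Qed.

Section Existence.
Hypothesis L_no_sources : no_sources L.

(** Degrees have infinitely many coordinates, so no single finite degree can be repeated to exhaust
    them. Step k adds 1 in the coordinates below k; each coordinate therefore grows at every step
    from some point on. *)
Let chain_step (k : nat) (f : mor L) : mor L :=
  mcomp f (sval (cid (L_no_sources (src f) (seq_mset (iota 0 k))))).

Let chain (f : mor L) : nat -> mor L :=
  fix c k := if k is k'.+1 then chain_step k' (c k') else f.

Let chain_stepP k f : exists2 g, src f = rng g & chain_step k f = mcomp f g /\
  deg g = seq_mset (iota 0 k).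
Proof.
by rewrite /chain_step; case: cid => g /= [h1 h2]; exists g.
Qed.

Let chain_ext f k j : exists2 g, src (chain f k) = rng g &
  chain f (j + k) = mcomp (chain f k) g.
Proof.
elim: j => [|j [g h1 h2]].
  by exists (idm (src (chain f k))); rewrite ?rng_idm ?comp_idr.
have [g' h3 [h4 _]] := chain_stepP (j + k) (chain f (j + k)).
rewrite h2 src_comp // in h3.
by exists (mcomp g g'); rewrite ?rng_comp // addSn /= h4 h2 Defs.compA.
Qed.

Let chain_deg f k i : (k <= deg (chain f k) i + i.+1)%N.
Proof.
elim: k => [//|k IHk] /=.
have [g h1 [h2 h3]] := chain_stepP k (chain f k).
rewrite h2 deg_comp // h3 msetE2 mset_seqE count_uniq_mem ?iota_uniq //.
by rewrite mem_iota; lia.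
Qed.

Let chain_cofinal f n : exists k, (n `<=` deg (chain f k))%mset.
Proof.
(* After k steps coordinate i has grown by at least k - (i + 1); the sum over the support dominates
   every n i + (i + 1). *)
exists (\sum_(i <- finsupp n) (n i + i.+1))%N; set k := (\sum_(_ <- _) _)%N.
apply/msubsetP => i; have [->//|ni] := eqVneq (n i) 0%N.
have := chain_deg f k i; suff : (n i + i.+1 <= k)%N by lia.
have hi : i \in finsupp n by rewrite mem_finsupp.
by rewrite /k (big_fsetD1 i) //= leq_addr.
Qed.

Lemma ipath_exists f : exists2 x, is_ipath x & x (deg f) = f.
Proof.
pose K n := sval (cid (chain_cofinal f n)).
have KP n : (n `<=` deg (chain f (K n)))%mset by rewrite /K; case: cid.
pose x n := init (chain f (K n)) n.
have xE k n : (n `<=` deg (chain f k))%mset -> x n = init (chain f k) n.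
  move=> hn; rewrite /x; case/orP: (leq_total k (K n)) => /subnK e.
    have [g h1] := chain_ext f k (K n - k); rewrite e => ->.
    by rewrite init_compl.
  have [g h1] := chain_ext f (K n) (k - K n); rewrite e => ->.
  by rewrite init_compl.
exists x; last by rewrite (xE 0%N) ?init_id ?msubset_refl.
split=> [n|m n mn]; first by have [] := split_atP (KP n).
rewrite (xE (K n) m) ?(msubset_trans mn) //.
have hm : (m `<=` deg (x n))%mset by have [_ _ ->] := split_atP (KP n).
have [h1 h2 h3] := split_atP hm.
have e : init (x n) m = init (chain f (K n)) m by rewrite init_init.
by exists (rest (x n) m); rewrite -e.
Qed.

End Existence.

End InfinitePaths.

(** * The graded path representation *)

Section PartialIsometries.
Variables (R : realType) (Y : choiceType).
Local Notation Z := (Y * bool)%type.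
Local Notation H := (l2 R Z).
Variables (phi psi : Y -> option Y).
Hypothesis phi_psi : partial_inverse phi psi.

Definition lift_bool (chi : Y -> option Y) (z : Z) : option Z :=
  omap (fun y => (y, z.2)) (chi z.1).

Lemma lift_boolP : partial_inverse (lift_bool phi) (lift_bool psi).
Proof.
move=> [y b] [y' b']; rewrite /lift_bool /=; split.
  by case E: (phi y) => [w|] //= -[<- <-]; rewrite ((phi_psi _ _).1 E).
by case E: (psi y') => [w|] //= -[<- <-]; rewrite ((phi_psi _ _).2 E).
Qed.

Lemma pull_adjoint (f g : H) :
  ip (MkL2 (pull_l2 f lift_boolP)) g =
  ip f (MkL2 (pull_l2 g (partial_inverse_sym lift_boolP))).
Proof.
apply: ip_eq.
have := has_sum_pull lift_boolP _
  (ipP f (MkL2 (pull_l2 g (partial_inverse_sym lift_boolP)))).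
rewrite (_ : pull _ _ = fun z => pull (lift_bool phi) f z * g z).
  by apply => w /= hw; rewrite /pull hw mulr0.
apply/funext => z; rewrite /pull /=.
case E: (lift_bool phi z) => [w|] /=; last by rewrite mul0r.
by rewrite ((lift_boolP _ _).1 E).
Qed.

Lemma partial_isometry_subproof :
  {T : bop R Y | (forall f y b, T f (y, b) = oapp (fun y' => f (y', b)) 0 (phi y)) /\
    forall f y b, bop_adj T f (y, b) = oapp (fun y' => f (y', b)) 0 (psi y)}.
Proof.
have hb : is_bounded_op (fun f : H => MkL2 (pull_l2 f lift_boolP)).
  split.
  - by exists (fun g => MkL2 (pull_l2 g (partial_inverse_sym lift_boolP))) => f g;
      exact: pull_adjoint.
  - move=> f; apply: l2_ext => -[y b]; rewrite /= /pull /lift_bool /= /Jfun /=.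
    rewrite /pull /lift_bool /=; case: (phi y) => [w|] /=; case: b => //=.
    by rewrite oppr0.
  - exists 1 => f; rewrite mul1r; apply: l2n_le; first exact: l2n_ge0.
    by move=> F; exact: sum_pull_sqr lift_boolP.
exists (MkBop (asboolT hb)); split=> f y b.
  by rewrite /= /pull /lift_bool /=; case: (phi y).
rewrite (_ : bop_adj _ f = MkL2 (pull_l2 f (partial_inverse_sym lift_boolP))).
  by rewrite /= /pull /lift_bool /=; case: (psi y).
by apply: ip_ext => g; rewrite ipC -bop_adjP pull_adjoint ipC.
Qed.

Definition partial_isometry : bop R Y := sval partial_isometry_subproof.

Lemma partial_isometryE f y b :
  partial_isometry f (y, b) = oapp (fun y' => f (y', b)) 0 (phi y).
Proof. by have [-> _] := svalP partial_isometry_subproof. Qed.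

Lemma partial_isometry_adjE f y b :
  bop_adj partial_isometry f (y, b) = oapp (fun y' => f (y', b)) 0 (psi y).
Proof. by have [_ ->] := svalP partial_isometry_subproof. Qed.

End PartialIsometries.

Lemma cs_mulE (R : realType) (Y : choiceType) (T U : bop_cstar R Y) f :
  (T ** U : bop R Y) f = (T : bop R Y) ((U : bop R Y) f).
Proof. exact: bop_compE. Qed.

Section PathRepresentation.
Variables (R : realType) (L : Ngraph) (H : set (vertex L)).
Hypotheses (L_row_finite : row_finite L) (H_hered : hereditary H).
Implicit Types (f g : mor L) (x : degree -> mor L).

Definition dz (m : degree) : nat -> int := fun i => (m i)%:Z.

Lemma dzD m n : dz (m `+` n)%mset = dz m + dz n.
Proof. by apply/funext => i; rewrite /dz msetE2 PoszD. Qed.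

Lemma dz_inj : injective dz.
Proof. by move=> m n e; apply/msetP => i; have [] := congr1 (@^~ i) e. Qed.

Definition enters x := is_ipath x /\ exists n, H (src (x n)).

Lemma enters_shift m x : enters x -> enters (shift m x).
Proof.
move=> [hx [n hn]]; split; first exact: shift_ipath.
exists n; rewrite src_shift //.
have [g h1 h2] := hx.2 _ _ (msubset_addl n m).
by rewrite h2 src_comp //; apply: H_hered; rewrite -h1.
Qed.

Lemma enters_prepend f x : enters x -> rng (x mset0) = src f ->
  enters (prepend f x).
Proof.
move=> [hx [n hn]] fx; split; first exact: prepend_ipath.
by exists (deg f `+` n)%mset; rewrite prependE // src_comp // rng_ipath.
Qed.

(* Basis points: an infinite path together with an integer degree; the second
   component makes the representation graded. *)
Local Notation Y := ((degree -> mor L) * (nat -> int))%type.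

(** Operators pull functions back, so the one built from deletion acts on basis vectors by
    insertion: it sends the vector at (x, k) to the one at (fx, k + deg f) when fx is defined, and
    its adjoint undoes this. *)
Definition del f (y : Y) : option Y :=
  if `[< enters y.1 /\ y.1 (deg f) = f >]
  then Some (shift (deg f) y.1, y.2 - dz (deg f)) else None.

Definition ins f (y : Y) : option Y :=
  if `[< enters y.1 /\ rng (y.1 mset0) = src f >]
  then Some (prepend f y.1, y.2 + dz (deg f)) else None.

Lemma del_ins f : partial_inverse (del f) (ins f).
Proof.
move=> [x k] [x' k']; rewrite /del /ins /=; split.
  case: asboolP => // -[hx fx] [<- <-]; rewrite rng_shift ?fx; last by case: hx.
  rewrite asboolT; last by split => //; exact: enters_shift.
  by rewrite -{1}fx prepend_shift ?subrK //; case: hx.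
case: asboolP => // -[hx fx] [<- <-]; have hi := hx.1.
rewrite asboolT; first by rewrite shift_prepend // addrK.
by split; [exact: enters_prepend | exact: prepend_init].
Qed.

Definition path_rep f : bop_cstar R Y := partial_isometry R (del_ins f).

Lemma path_repE f (xi : l2 R (Y * bool)%type) y b :
  (path_rep f : bop R Y) xi (y, b) = oapp (fun y' => xi (y', b)) 0 (del f y).
Proof. exact: partial_isometryE. Qed.

Lemma path_rep_adjE f (xi : l2 R (Y * bool)%type) y b :
  ((path_rep f)^# : bop R Y) xi (y, b) = oapp (fun y' => xi (y', b)) 0 (ins f y).
Proof. exact: partial_isometry_adjE. Qed.

Lemma shift0 x : is_ipath x -> shift mset0 x = x.
Proof.
move=> hx; apply/funext => n; have [h1 h2 h3] := shiftP mset0 n hx.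
by move: h3 h1; rewrite mset0D ipath0 // src_idm => -> ->; rewrite comp_idl.
Qed.

Lemma del_idm v (y : Y) :
  del (idm v) y = if `[< enters y.1 /\ rng (y.1 mset0) = v >] then Some y else None.
Proof.
case: y => x k; rewrite /del /= deg_idm (_ : dz mset0 = 0); last first.
  by apply/funext => i; rewrite /dz mset0E.
rewrite subr0; case: asboolP => [[hx e]|h]; case: asboolP => [h'|h'] //.
- by rewrite shift0 //; case: hx.
- by case: h'; split=> //; rewrite e rng_idm.
- case: h; split; first by case: h'.
  by case: h' => -[hx _] <-; rewrite -ipath0.
Qed.

Lemma del_comp f g y : src f = rng g ->
  del (mcomp f g) y = obind (del g) (del f y).
Proof.
case: y => x k fg; rewrite /del /=.
case: asboolP => [[hx /(ipath_eq_comp hx.1 fg)[h1 h2]]|h].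
  rewrite (asboolT (conj hx h1)) /= (asboolT (conj (enters_shift _ hx) h2)).
  by rewrite deg_comp // (shiftD _ _ hx.1) dzD opprD addrA.
case: asboolP => //= -[hx h1]; case: asboolP => //= -[_ h2]; case: h.
by split=> //; apply/(ipath_eq_comp hx.1 fg).
Qed.

Lemma del_comp0 f g y : src f <> rng g -> obind (del g) (del f y) = None.
Proof.
case: y => x k fg; rewrite /del /=.
case: asboolP => //= -[hx h1]; case: asboolP => //= -[hx' h2]; case: fg.
have hs := shift_ipath (deg f) hx.1.
by rewrite -h2 (rng_ipath _ hs) rng_shift ?h1 //; case: hx.
Qed.

Lemma del_defined f y : (del f y : bool) = `[< enters y.1 /\ y.1 (deg f) = f >].
Proof. by rewrite /del; case: asboolP. Qed.

Lemma path_rep_proj f (xi : l2 R (Y * bool)%type) y b :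
  (path_rep f ** (path_rep f)^# : bop R Y) xi (y, b) =
  if del f y then xi (y, b) else 0.
Proof.
rewrite cs_mulE path_repE; case E: (del f y) => [y'|] //=.
by rewrite path_rep_adjE ((del_ins f _ _).1 E).
Qed.

Lemma path_rep_coproj f (xi : l2 R (Y * bool)%type) y b :
  ((path_rep f)^# ** path_rep f : bop R Y) xi (y, b) =
  if ins f y then xi (y, b) else 0.
Proof.
rewrite cs_mulE path_rep_adjE; case E: (ins f y) => [y'|] //=.
by rewrite path_repE ((del_ins f _ _).2 E).
Qed.

Lemma path_rep_CK2 f g : src f = rng g ->
  path_rep f ** path_rep g = path_rep (mcomp f g).
Proof.
move=> fg; apply: bop_ext => xi; apply: l2_ext => -[y b].
by rewrite cs_mulE !path_repE del_comp //; case: (del f y) => //= y'; rewrite path_repE.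
Qed.

Lemma path_rep_CK2_zero f g : src f <> rng g -> path_rep f ** path_rep g = 0.
Proof.
move=> fg; apply: bop_ext => xi; apply: l2_ext => -[y b].
rewrite cs_mulE path_repE bop0E l20; have := del_comp0 y fg.
by case: (del f y) => //= y'; rewrite path_repE => ->.
Qed.

Lemma path_rep_CK3 f : (path_rep f)^# ** path_rep f = path_rep (idm (src f)).
Proof.
apply: bop_ext => xi; apply: l2_ext => -[y b].
rewrite path_rep_coproj path_repE del_idm /ins.
by case: asboolP.
Qed.

Lemma path_rep_CK : CK_family path_rep.
Proof.
have idm_idem v : path_rep (idm v) ** path_rep (idm v) = path_rep (idm v).
  by rewrite path_rep_CK2 ?src_idm ?rng_idm // -{1}[v]rng_idm comp_idl.
split.
- move=> f; rewrite -cs_mulA path_rep_CK3 path_rep_CK2 ?rng_idm //.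
  by rewrite comp_idr.
- move=> v; split=> //.
  by rewrite -{1}[v]src_idm -path_rep_CK3 cs_starM cs_starK path_rep_CK3 src_idm.
- by move=> v w vw; apply: path_rep_CK2_zero; rewrite src_idm rng_idm.
- exact: path_rep_CK2.
- exact: path_rep_CK2_zero.
- exact: path_rep_CK3.
- move=> v n; apply: bop_ext => xi; apply: l2_ext => -[y b].
  rewrite fsbig_finite; last exact: L_row_finite.
  pose ev (T : bop R Y) := T xi (y, b).
  rewrite -[RHS]/(ev _) (big_morph ev (id1 := 0) (op1 := +%R)); last first.
  - by rewrite /ev bop0E.
  - by move=> T U; rewrite /ev bopD l2D.
  rewrite path_repE del_idm; case: asboolP => [[hy hv]|h] /=.
    (* At the basis point [y] the only nonzero term of the CK4 sum is the one for the initial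
       segment [y.1 n]. *)
    have hyn : y.1 n \in fset_set (paths_from v n).
      rewrite (in_fset_set (L_row_finite v n)) inE.
      by split; [rewrite (rng_ipath n hy.1) hv | case: hy => -[]].
    rewrite (big_fsetD1 _ hyn) /= [X in _ + X]big1_seq ?addr0.
      rewrite /ev path_rep_proj del_defined asboolT //; split => //.
      by rewrite (hy.1).1.
    move=> f /=; rewrite !inE => /andP[fn]; rewrite (in_fset_set (L_row_finite v n)) inE => -[_ df].
    rewrite /ev path_rep_proj del_defined; case: asboolP => // -[_ e].
    by move: fn; rewrite -e df eqxx.
  rewrite big1_seq // => f /=; rewrite (in_fset_set (L_row_finite v n)) inE => -[rf df].
  rewrite /ev path_rep_proj del_defined; case: asboolP => // -[hy e]; case: h.
  by split => //; rewrite -rf -e (rng_ipath _ hy.1).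
Qed.

End PathRepresentation.

(** * Orthogonality of projections summing to a projection *)

Section CstarNorm.
Variables (R : realType) (A : cstar_alg R).
Implicit Types (x y z e p q : A) (a : R[i]).

Lemma cs_mul0l x : 0 ** x = 0.
Proof. by rewrite -(scale0r 0) cs_scalel !scale0r. Qed.
Lemma cs_mul0r x : x ** 0 = 0.
Proof. by rewrite -(scale0r 0) cs_scaler !scale0r. Qed.
Lemma cs_mulNl x y : - x ** y = - (x ** y).
Proof. by rewrite -scaleN1r cs_scalel scaleN1r. Qed.
Lemma cs_mulNr x y : x ** - y = - (x ** y).
Proof. by rewrite -scaleN1r cs_scaler scaleN1r. Qed.
Lemma cs_mulBl x y z : (x - y) ** z = x ** z - y ** z.
Proof. by rewrite cs_mulDl cs_mulNl. Qed.
Lemma cs_mulBr x y z : x ** (y - z) = x ** y - x ** z.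
Proof. by rewrite cs_mulDr cs_mulNr. Qed.
Lemma cs_star0 : (0 : A)^# = 0.
Proof. by rewrite -(scale0r 0) cs_starZ conjC0 !scale0r. Qed.
Lemma cs_starN x : (- x)^# = - x^#.
Proof. by rewrite -scaleN1r cs_starZ conjCN1 scaleN1r. Qed.
Lemma cs_starB x y : (x - y)^# = x^# - y^#.
Proof. by rewrite cs_starD cs_starN. Qed.

Lemma cs_mul_suml I (r : seq I) (P : pred I) (F : I -> A) x :
  (\sum_(i <- r | P i) F i) ** x = \sum_(i <- r | P i) F i ** x.
Proof.
by apply: (big_morph (fun y => y ** x)) => [y z|]; rewrite ?cs_mulDl ?cs_mul0l.
Qed.
Lemma cs_mul_sumr I (r : seq I) (P : pred I) (F : I -> A) x :
  x ** (\sum_(i <- r | P i) F i) = \sum_(i <- r | P i) x ** F i.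
Proof.
by apply: (big_morph (fun y => x ** y)) => [y z|]; rewrite ?cs_mulDr ?cs_mul0r.
Qed.

Definition cn x : R := complex.Re `|x|.

Lemma cnE x : `|x| = (cn x)%:C.
Proof. by rewrite /cn RRe_real // normr_real. Qed.

Lemma cn_ge0 x : 0 <= cn x.
Proof. by rewrite -ler0c -cnE. Qed.

Lemma cnD x y : cn (x + y) <= cn x + cn y.
Proof. by rewrite -lecR rmorphD /= -!cnE ler_normD. Qed.

Lemma cnZ a x : cn (a *: x) = complex.Re `|a| * cn x.
Proof.
have aE : `|a| = (complex.Re `|a|)%:C by rewrite RRe_real // normr_real.
apply: complexI; rewrite -cnE normrZ cnE aE; exact: esym (rmorphM _ _ _).
Qed.

Lemma cnZr (r : R) x : cn (r%:C *: x) = `|r| * cn x.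
Proof. by rewrite cnZ normc_def /= expr0n addr0 sqrtr_sqr. Qed.

Lemma cnN x : cn (- x) = cn x. Proof. by rewrite /cn normrN. Qed.
Lemma cn0 : cn 0 = 0. Proof. by rewrite /cn normr0. Qed.

Lemma cnB x y : cn (x - y) <= cn x + cn y.
Proof. by rewrite -(cnN y) cnD. Qed.

Lemma cn_eq0 x : cn x = 0 -> x = 0.
Proof. by move=> h; apply/normr0_eq0; rewrite cnE h. Qed.

Lemma cnM x y : cn (x ** y) <= cn x * cn y.
Proof. by rewrite -lecR rmorphM /= -!cnE cs_normM. Qed.

Lemma cnM_le1 x y : cn x <= 1 -> cn y <= 1 -> cn (x ** y) <= 1.
Proof.
by move=> hx hy; rewrite (le_trans (cnM _ _)) // mulr_ile1 ?cn_ge0.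
Qed.

Lemma cn_starM x : cn (x^# ** x) = cn x ^+ 2.
Proof. by apply: complexI; rewrite rmorphXn /= -!cnE cs_norm. Qed.

Lemma cn_sum I (r : seq I) (P : pred I) (F : I -> A) :
  cn (\sum_(i <- r | P i) F i) <= \sum_(i <- r | P i) cn (F i).
Proof.
elim/big_rec2: _ => [|i c y _ h]; first by rewrite cn0.
by rewrite (le_trans (cnD _ _)) // lerD.
Qed.

Lemma cn_star_le x : cn x <= cn x^#.
Proof.
have [x0|x0] := eqVneq (cn x) 0; first by rewrite x0 cn_ge0.
have xp : 0 < cn x by rewrite lt_neqAle eq_sym x0 cn_ge0.
by rewrite -(ler_pM2r xp) -expr2 -cn_starM cnM.
Qed.

Lemma cn_star x : cn x^# = cn x.
Proof.
by apply/eqP; rewrite eq_le cn_star_le andbT -{2}(cs_starK x) cn_star_le.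
Qed.

Lemma cn_mul_star x : cn (x ** x^#) = cn x ^+ 2.
Proof. by rewrite -{1}(cs_starK x) cn_starM cn_star. Qed.

Lemma cs_starM_eq0 x : x^# ** x = 0 -> x = 0.
Proof.
by move=> h; apply: cn_eq0; apply/eqP; rewrite -sqrf_eq0 -cn_starM h cn0.
Qed.

Lemma cs_Mstar_eq0 x : x ** x^# = 0 -> x = 0.
Proof.
by move=> h; apply: cn_eq0; apply/eqP; rewrite -sqrf_eq0 -cn_mul_star h cn0.
Qed.

Definition is_proj p := p^# = p /\ p ** p = p.

Lemma cn_proj p : is_proj p -> cn p <= 1.
Proof.
move=> [ps pp]; have h : cn p ^+ 2 = cn p by rewrite -cn_starM ps pp.
have [->//|p0] := eqVneq (cn p) 0.
by rewrite -(ler_pM2r (_ : 0 < cn p)) ?mul1r -?expr2 ?h // lt_neqAle eq_sym p0 cn_ge0.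
Qed.

End CstarNorm.

(** A root w of w^(2^k) = -1 has order dividing 2^(k+1); a smaller order would divide 2^k and force
    -1 = 1. *)
Lemma prim_root_pow2 (R : realType) k : exists w : R[i], (2 ^ k.+1).-primitive_root w.
Proof.
have k0 : (0 < 2 ^ k)%N by rewrite expn_gt0.
pose w : R[i] := (2 ^ k).-root (-1); exists w.
have w2 : w ^+ (2 ^ k) = -1 by rewrite rootCK.
have w1 : w ^+ (2 ^ k.+1) = 1 by rewrite expnS mulnC exprM w2 sqrrN expr1n.
have [|m hm] := prim_order_exists _ w1; first by rewrite expn_gt0.
move=> /(dvdn_pfactor _ _ (isT : prime 2))[j jk mE]; move: hm; rewrite mE.
have [->//|jk'] := eqVneq j k.+1.
move=> /prim_expr_order h; have : (2 ^ j %| 2 ^ k)%N.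
  by rewrite dvdn_exp2l // -ltnS ltn_neqAle jk'.
move=> /dvdnP[t e]; have := w2; rewrite e mulnC exprM h expr1n => /eqP.
by rewrite -subr_eq0 opprK -(natrD _ 1 1) pnatr_eq0.
Qed.

(** * The unit of a corner is an extreme point of its unit ball *)

Section ExtremeUnit.
Variables (R : realType) (A : cstar_alg R).
Variables (e x : A).
Hypotheses (ee : is_proj e) (xs : x^# = x) (ex : e ** x = x) (xe : x ** e = x).
Hypotheses (h1 : cn (e + x) <= 1) (h2 : cn (e - x) <= 1).

Let xpow n := iter n (fun y => y ** x) e.
(** Polynomial evaluation at [x] inside the corner of [e]: the constant 1 goes to [e], because the
    algebra need not have a unit. *)
Let ev (p : {poly R[i]}) := \sum_(i < size p) p`_i *: xpow i.

Let ev_wide n (p : {poly R[i]}) : (size p <= n)%N -> ev p = \sum_(i < n) p`_i *: xpow i.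
Proof.
move=> hn; rewrite /ev (big_ord_widen n (fun i => p`_i *: xpow i)) //.
rewrite big_mkcond; apply: eq_bigr => i _; case: ltnP => // hi.
by rewrite nth_default // scale0r.
Qed.

Let size_lin (c : R[i]) : (size (1 + c *: 'X : {poly R[i]})%R <= 2)%N.
Proof.
rewrite (leq_trans (size_polyD _ _)) // size_poly1 geq_max /=.
by rewrite (leq_trans (size_scale_leq _ _)) ?size_polyX.
Qed.

Let ev_step (p : {poly R[i]}) (c : R[i]) : ev (p * (1 + c *: 'X)) = ev p ** (e + c *: x).
Proof.
rewrite (@ev_wide (size p).+1); last first.
  have hq := size_lin c.
  rewrite (leq_trans (size_polyMleq _ _)) //; lia.
have xpe i : xpow i ** e = xpow i.
  by case: i => [|i]; [case: ee | rewrite /= -cs_mulA xe].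
rewrite cs_mulDr cs_scaler /ev !cs_mul_suml mulrDr mulr1 -scalerAr.
under eq_bigr do rewrite coefD coefZ coefMX scalerDl.
rewrite big_split /=; congr (_ + _).
  rewrite big_ord_recr /= nth_default // scale0r addr0.
  by apply: eq_bigr => i _; rewrite cs_scalel xpe.
rewrite big_ord_recl /= mulr0 scale0r add0r scaler_sumr.
by apply: eq_bigr => i _; rewrite cs_scalel scalerA.
Qed.

(** For r = 1 or -1 the C*-identity reduces e + i r x to e + x^2, the mean of (e + x)^2 and (e -
    x)^2. *)
Let i_bound (r : R) : `|r| = 1 -> cn (e + (r *i)%C *: x) <= 1.
Proof.
move=> r1; have r2 : r ^+ 2 = 1 by rewrite -real_normK ?num_real // r1 expr1n.
rewrite -(@expr_le1 _ 2) ?cn_ge0 // -cn_starM cs_starD cs_starZ.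
case: (ee) => es e2; rewrite es xs cs_mulDl !cs_mulDr e2 !(cs_scalel, cs_scaler).
rewrite ex xe scalerA.
have -> : e + (r *i)%C *: x + (Num.conj (r *i)%C *: x +
    ((r *i)%C * Num.conj (r *i)%C) *: (x ** x)) = e + x ** x.
  rewrite -!addrA; congr (_ + _); rewrite addrA -scalerDl.
  have -> : (r *i)%C + Num.conj (r *i)%C = 0 :> R[i].
    by apply/eqP; rewrite eq_complex /= addr0 subrr !eqxx.
  have -> : (r *i)%C * Num.conj (r *i)%C = 1 :> R[i].
    apply/eqP; rewrite eq_complex /= !mul0r !mulr0 mulrN sub0r opprK -expr2 r2.
    by rewrite addr0 !eqxx.
  by rewrite scale0r scale1r add0r.
have -> : e + x ** x = (2^-1 : R)%:C *: ((e + x) ** (e + x) + (e - x) ** (e - x)).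
  rewrite !cs_mulDl !cs_mulDr !cs_mulNl !cs_mulNr e2 ex xe opprK.
  rewrite (_ : _ + _ + _ = 2%:R *: (e + x ** x)).
    rewrite scalerA -(rmorph_nat (real_complex R)) -rmorphM /= mulVf ?scale1r //.
  rewrite scaler_nat mulr2n addrACA [e + x + _]addrACA [x + _ + _]addrACA.
  by rewrite !subrr addr0 add0r addrACA.
rewrite cnZr ger0_norm ?invr_ge0 // ler_pdivrMl // mulr1.
rewrite (le_trans (cnD _ _)) // -[2%:R](_ : 1 + 1 = _) // lerD //;
  by rewrite (le_trans (cnM _ _)) // mulr_ile1 ?cn_ge0.
Qed.

Let lin_regroup (u v w s t : R[i]) :
  u *: e + (v *: (e + s *: x) + w *: (e + t *: x)) =
  (u + v + w) *: e + (v * s + w * t) *: x.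
Proof.
rewrite !scalerDr !scalerDl !scalerA -!addrA.
by congr (_ + (_ + _)); rewrite addrCA.
Qed.

(** For such c, the element e + c x is a convex combination of e, one of e + x and e - x, and one of
    e + i x and e - i x. *)
Let disc_bound (c : R[i]) :
  `|complex.Re c| + `|complex.Im c| <= 1 -> cn (e + c *: x) <= 1.
Proof.
case: c => a b /= ab.
(* The sign, with 1 in place of 0 at the origin, so that it always has modulus 1. *)
pose sa : R := Num.sg a + (a == 0)%:R; pose sb : R := Num.sg b + (b == 0)%:R.
have hs (t : R) : `|Num.sg t + (t == 0)%:R| = 1 /\
    t = `|t| * (Num.sg t + (t == 0)%:R).
  have [->|t0] := eqVneq t 0; first by rewrite sgr0 add0r normr1 normr0 mul0r.
  by rewrite addr0 normr_sg t0 mulrC -numEsg.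
have [na ea] := hs a; have [nb eb] := hs b; rewrite -/sa -/sb in na ea nb eb.
have -> : e + (a +i* b)%C *: x = (1 - `|a| - `|b|)%:C *: e +
    (`|a|%:C *: (e + sa%:C *: x) + `|b|%:C *: (e + (sb *i)%C *: x)).
  rewrite lin_regroup; congr (_ + _); last first.
    congr (_ *: _); apply/eqP; rewrite eq_complex /=; simpc.
    by rewrite -ea -eb !eqxx.
  rewrite -[LHS]scale1r; congr (_ *: _).
  by apply/eqP; rewrite eq_complex /= !addr0 eqxx andbT; apply/eqP; ring.
have hsa : cn (e + sa%:C *: x) <= 1.
  move/eqP: na; rewrite eqr_norml ler01 andbT => /orP[]/eqP ->.
    by rewrite scale1r.
  by rewrite rmorphN1 scaleN1r.
have hsb := i_bound nb.
have ab0 : 0 <= 1 - `|a| - `|b| by move: ab; lra.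
rewrite (le_trans (cnD _ _)) //.
apply: (@le_trans _ _ ((1 - `|a| - `|b|) + (`|a| + `|b|))); last first.
  by lra.
rewrite lerD //; first by rewrite cnZr (ger0_norm ab0) ler_piMr ?cn_proj.
rewrite (le_trans (cnD _ _)) // lerD // cnZr normr_id ler_piMr //.
Qed.

Let pow_bound (c : R[i]) n : `|complex.Re c| + `|complex.Im c| <= 1 ->
  cn (ev ((1 + c *: 'X) ^+ n)) <= 1.
Proof.
move=> hc; elim: n => [|n IHn].
  rewrite expr0 /ev size_poly1 big_ord1 coef1 scale1r; exact: cn_proj.
by rewrite exprSr ev_step; apply: cnM_le1 => //; exact: disc_bound.
Qed.

Let ev_pow (c : R[i]) n : ev ((1 + c *: 'X) ^+ n) =
  \sum_(i < n.+1) (c ^+ i *+ 'C(n, i)) *: xpow i.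
Proof.
have hc i : ((1 + c *: 'X) ^+ n)`_i = c ^+ i *+ 'C(n, i).
  rewrite addrC exprD1n coef_sum.
  under eq_bigr do rewrite exprZn coefMn coefZ coefXn.
  have [hi|hi] := ltnP i n.+1.
    rewrite (bigD1 (Ordinal hi)) //= eqxx mulr1 big1 ?addr0 // => j ji.
    rewrite (_ : (i == j) = false) ?mulr0 ?mul0rn //.
    by apply: contraNF ji => /eqP e'; apply/eqP/val_inj.
  rewrite bin_small // mulr0n big1 // => j _.
  rewrite (_ : (i == j) = false) ?mulr0 ?mul0rn //.
  by apply/negbTE; rewrite neq_ltn (leq_trans (ltn_ord j)) ?orbT.
rewrite (@ev_wide n.+1); first by apply: eq_bigr => i _; rewrite hc.
have hq := size_lin c.
rewrite (leq_trans (size_poly_exp_leq _ _)) // ltnS.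
by case: (size _) hq => [|[|[|m]]] //= _; rewrite ?mul0n ?mul1n.
Qed.

(* The coefficient [n x / 2] of [(e + z x / 2)^n] is an average of contractions
   over roots of unity [z], for every [n]. *)
Lemma extreme_unit : x = 0.
Proof.
have bound n : n%:R * cn x <= 2.
  have [->|n0] := eqVneq n 0%N; first by rewrite mul0r.
  have [k nk] : exists k, (n < 2 ^ k.+1)%N.
    by exists n; rewrite (ltn_trans (ltnSn n)) // ltn_expl.
  set N := (2 ^ k.+1)%N in nk; have [w hw] := prim_root_pow2 R k.
  have wN : w ^+ N = 1 by apply: prim_expr_order.
  have N0 : (0 < N)%N by rewrite expn_gt0.
  have NR : N%:R != 0 :> R by rewrite pnatr_eq0 -lt0n.
  have NC : N%:R != 0 :> R[i] by rewrite pnatr_eq0 -lt0n.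
  have w0 : w != 0.
    by apply: contra_eq_neq wN => ->; rewrite expr0n gtn_eqF // eq_sym oner_eq0.
  have w1 : `|w| = 1.
    by apply/eqP; rewrite -(pexpr_eq1 N0 (normr_ge0 w)) -normrX wN normr1.
  (* Summing over j extracts the Fourier coefficient of index 1; as N > n, no other exponent up to n
     is congruent to 1 modulo N. The factor 1/2 gives |Re| + |Im| <= 1, as [pow_bound] requires. *)
  pose F (j : 'I_N) := w^-1 ^+ j *: ev ((1 + (w ^+ j / 2) *: 'X) ^+ n).
  have FE : \sum_j F j = (N%:R * 2^-1 * n%:R) *: x.
    transitivity (\sum_(i < n.+1) (\sum_(j < N) (w^-1 * w ^+ i) ^+ j) *:
        ((2^-1 ^+ i *+ 'C(n, i)) *: xpow i)).
      under [RHS]eq_bigr do rewrite scaler_suml.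
      rewrite [RHS]exchange_big /=; apply: eq_bigr => j _.
      rewrite /F ev_pow scaler_sumr; apply: eq_bigr => i _.
      rewrite !scalerA; congr (_ *: _).
      by rewrite !exprMn -!exprM (mulnC i) !mulrnAr mulrA.
    have n1 : (1 < n.+1)%N by rewrite ltnS lt0n.
    rewrite (bigD1 (Ordinal n1)) //= [X in _ + X]big1 ?addr0 => [|i i1].
      rewrite !expr1 mulVf // (eq_bigr (fun=> 1)) => [|j _]; last by rewrite expr1n.
      rewrite sumr_const card_ord bin1 ex scalerA; congr (_ *: _).
      by rewrite -mulrA mulr_natr.
    set r := _ * _; have rN : r ^+ N = 1 by rewrite exprMn exprVn wN invr1 mul1r exprAC wN expr1n.
    have r1 : r != 1.
      rewrite -(inj_eq (mulfI w0)) mulr1 mulrA mulfV // mul1r -[X in _ != X]expr1.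
      rewrite (eq_prim_root_expr hw) !modn_small //; last first.
        by rewrite (leq_trans _ nk) // ltnS lt0n.
      by rewrite (leq_ltn_trans _ nk) // -ltnS.
    have : (r - 1) * (\sum_(j < N) r ^+ j) = 0 by rewrite -subrX1 rN subrr.
    move=> /eqP; rewrite mulf_eq0 subr_eq0 (negbTE r1) /= => /eqP ->.
    by rewrite scale0r.
  have FB : cn (\sum_j F j) <= N%:R.
    rewrite (le_trans (cn_sum _ _ _)) //.
    apply: (@le_trans _ _ (\sum_(j < N) 1)); last by rewrite sumr_const card_ord.
    apply: ler_sum => j _; rewrite /F cnZ normrX normfV w1 invr1 expr1n mul1r.
    apply: pow_bound; have : `|w ^+ j / 2| = (2^-1 : R)%:C.
      rewrite normrM normrX w1 expr1n mul1r normfV normr_nat.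
      by rewrite fmorphV rmorph_nat.
    move: (w ^+ j / 2) => c cE.
    have hre := normc_ge_Re c; rewrite cE lecR in hre.
    have him := normc_ge_Re (c * 'i%C).
    rewrite ReiNIm normrN normrM cE (_ : `|'i%C| = 1) ?mulr1 ?lecR in him; last first.
      by rewrite normc_def /= expr0n expr1n add0r sqrtr1.
    by rewrite (le_trans (lerD hre him)) //; lra.
  move: FB; rewrite FE cnZ.
  have -> : complex.Re `|N%:R * 2^-1 * n%:R : R[i]| = N%:R * 2^-1 * n%:R.
    rewrite !normrM normfV !normr_nat.
    rewrite -!(rmorph_nat (real_complex R)) -fmorphV -!rmorphM /=.
    by [].
  rewrite -!mulrA ger_pMr ?ltr0n // ler_pdivrMl // mulr1 //.
apply: cn_eq0; apply/eqP; rewrite eq_le cn_ge0 andbT leNgt; apply/negP => x0.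
have q0 : 0 <= 2 / cn x by rewrite divr_ge0 ?ltW.
by have := archi_boundP q0; rewrite ltr_pdivrMr // ltNge bound.
Qed.

End ExtremeUnit.

Section OrthogonalProjections.
Variables (R : realType) (A : cstar_alg R) (I : choiceType).

(** Compress by q_i: the elements a_k = q_i q_k q_i add up to q_i P q_i = q_i, and a_i = q_i
    already, so the others add up to 0. In place of positivity, this gives two-sided norm bounds on
    a multiple of a_j, which [extreme_unit] then kills; and a_j = (q_i q_j)(q_i q_j)^#. *)
Lemma sum_proj_orth (S : {fset I}) (q : I -> A) (P : A) :
  is_proj P -> (forall i, i \in S -> is_proj (q i)) ->
  (forall i, i \in S -> P ** q i = q i) -> P = \sum_(i <- S) q i ->
  forall i j, i \in S -> j \in S -> i != j -> q i ** q j = 0.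
Proof.
move=> hP hq Pq PE i j iS jS ij.
have qP k : k \in S -> q k ** P = q k.
  by move=> kS; rewrite -[LHS]cs_starK cs_starM (hP.1) (hq k kS).1 Pq // (hq k kS).1.
have [qs qq] := hq i iS; have [js jj] := hq j jS.
pose a k := q i ** q k ** q i.
have as_ k : k \in S -> (a k)^# = a k.
  by move=> kS; rewrite /a !cs_starM qs (hq k kS).1 cs_mulA.
have qa k : q i ** a k = a k by rewrite /a !cs_mulA qq.
have aq k : a k ** q i = a k by rewrite /a -!cs_mulA qq.
have ha k : k \in S -> cn (q i - a k) <= 1.
  move=> kS; have -> : q i - a k = q i ** (P - q k) ** q i.
    by rewrite cs_mulBr cs_mulBl qP // qq.
  have hPk : is_proj (P - q k).
    split; first by rewrite cs_starB hP.1 (hq k kS).1.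
    by rewrite cs_mulBl !cs_mulBr hP.2 Pq // qP // (hq k kS).2 subrr subr0.
  by apply: cnM_le1; [apply: cnM_le1|]; apply: cn_proj => //; exact: hq.
have jSi : j \in (S `\ i)%fset by rewrite !inE eq_sym ij.
pose T := ((S `\ i) `\ j)%fset.
have sum0 : a j + \sum_(k <- T) a k = 0.
  rewrite -(big_fsetD1 j (F := a)) //.
  apply: (@addrI _ (a i)); rewrite -(big_fsetD1 i (F := a)) // addr0.
  by rewrite -cs_mul_suml -cs_mul_sumr -PE qP // /a qq.
have TS k : k \in T -> k \in S by rewrite !inE => /andP[_ /andP[]].
pose N := size T; pose M : R := N.+1%:R.
have M0 : 0 < M by rewrite ltr0n.
have hN : cn (N%:R%:C *: q i + a j) <= N%:R.
  have -> : N%:R%:C *: q i + a j = \sum_(k <- T) (q i - a k).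
    rewrite big_split /= big_const_seq count_predT -/N iter_addr_0.
    rewrite sumrN rmorph_nat scaler_nat; congr (_ + _).
    by apply/eqP; rewrite -subr_eq0 opprK sum0.
  rewrite (le_trans (cn_sum _ _ _)) //.
  apply: (@le_trans _ _ (\sum_(k <- T) 1)).
    by rewrite big_seq [leRHS]big_seq; apply: ler_sum => k /TS/ha.
  by rewrite big_const_seq count_predT -/N iter_addr_0.
(* With M = N + 1, q_i + x is the average of N q_i + a_j, of norm at most N, and one more q_i, while
   q_i - x is a convex combination of q_i and q_i - a_j. *)
pose x := M^-1%:C *: a j.
have Mi : 0 <= M^-1 by rewrite invr_ge0 ltW.
have x0 : x = 0.
  apply: (@extreme_unit _ _ (q i)) => //.
  - rewrite /x cs_starZ as_ //; congr (_ *: _).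
    by apply/eqP; rewrite eq_complex /= oppr0 !eqxx.
  - by rewrite /x cs_scaler qa.
  - by rewrite /x cs_scalel aq.
  - have -> : q i + x = M^-1%:C *: ((N%:R%:C *: q i + a j) + q i).
      rewrite addrAC scalerDr -/x -{3}[q i]scale1r -scalerDl scalerA.
      rewrite (_ : _ * _ = 1) ?scale1r // -(rmorph1 (real_complex R)) -rmorphD -rmorphM /=.
      by rewrite /M -natr1 mulVf // natr1 pnatr_eq0.
    rewrite cnZr (ger0_norm Mi) ler_pdivrMl // mulr1 (le_trans (cnD _ _)) //.
    by rewrite /M -natr1 lerD // cn_proj.
  - have -> : q i - x = (1 - M^-1)%:C *: q i + M^-1%:C *: (q i - a j).
      by rewrite scalerBr -/x addrA -scalerDl -rmorphD /= subrK scale1r.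
    have M1 : 0 <= 1 - M^-1 by rewrite subr_ge0 invf_le1 // ler1n.
    rewrite (le_trans (cnD _ _)) // !cnZr (ger0_norm Mi) (ger0_norm M1).
    have h3 := ler_wpM2l Mi (ha j jS).
    have h4 := ler_wpM2l M1 (cn_proj (hq i iS)).
    by rewrite (le_trans (lerD h4 h3)) // !mulr1 subrK.
have aj0 : a j = 0.
  move: x0 => /eqP; rewrite scaler_eq0 => /orP[|/eqP//].
  by rewrite -(rmorph0 (real_complex R)) (inj_eq (@complexI R)) invr_eq0 gt_eqF.
apply: cs_Mstar_eq0; rewrite cs_starM qs js.
by rewrite -cs_mulA (cs_mulA (q j)) jj cs_mulA.
Qed.

End OrthogonalProjections.

(** * Contractivity of representations *)

Section Neumann.
Variables (R : realType) (A : cstar_alg R).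

Lemma expr_small (r e : R) : 0 <= r -> r < 1 -> 0 < e -> exists n, r ^+ n < e.
Proof.
move=> r0 r1 e0; have : (fun n => r ^+ n) @ \oo --> (0 : R).
  by apply: cvg_expr; rewrite ger0_norm.
move=> /cvgrPdist_lt /(_ e e0) [n _ /(_ n (leqnn n))] /=.
by rewrite sub0r normrN ger0_norm ?exprn_ge0 // => h; exists n.
Qed.

(** y = h + h^2 + ..., so that formally 1 + y is a right inverse of 1 - h, phrased without a
    unit. *)
Lemma neumann (h : A) : cn h < 1 -> exists y, y = h + h ** y.
Proof.
move=> h1; set r := cn h in h1; have r0 : 0 <= r by exact: cn_ge0.
pose u n := iter n (fun y => h + h ** y) 0.
pose C := (1 - r)^-1; have C0 : 0 < C by rewrite invr_gt0 subr_gt0.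
have CE : C = 1 + r * C by rewrite /C; field; rewrite subr_eq0 gt_eqF.
have hu n : cn (u n) <= C.
  elim: n => [|n IHn] /=; first by rewrite cn0 ltW.
  rewrite (le_trans (cnD _ _)) // [leRHS]CE lerD ?(ltW h1) //.
  by rewrite (le_trans (cnM _ _)) // ler_wpM2l.
have hd n k : cn (u (n + k)%N - u n) <= r ^+ n * C.
  elim: n => [|n IHn]; first by rewrite subr0 expr0 mul1r.
  rewrite addSn /= opprD addrACA subrr add0r -cs_mulBr exprS -mulrA.
  by rewrite (le_trans (cnM _ _)) // ler_wpM2l.
have /cvg_ex[y hy] : cvg (u @ \oo).
  apply: cauchy_cvg; apply: cauchy_exP => e e0.
  have [eps eps0 eE] : exists2 eps : R, 0 < eps & e = eps%:C.
    exists (complex.Re e); first by move: e0; rewrite ltcE => /andP[].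
    by rewrite RRe_real // gtr0_real.
  have [n hn] := expr_small r0 h1 (divr_gt0 eps0 C0).
  exists (u n); exists n => // m /= nm; rewrite -ball_normE /= eE.
  rewrite -(subnKC nm) distrC cnE ltcR (le_lt_trans (hd _ _)) //.
  by rewrite -ltr_pdivlMr.
exists y; apply/eqP; rewrite -subr_eq0; apply/eqP/cn_eq0/eqP.
rewrite eq_le cn_ge0 andbT; apply/ler_addgt0Pl => e e0; rewrite addr0.
have e2 : 0 < e / 2 by rewrite divr_gt0.
have e2c : 0 < (e / 2)%:C :> R[i] by rewrite ltcR.
move: hy => /cvgrPdist_lt /(_ _ e2c) [n _ hn].
have h2 : cn (y - u n) <= e / 2.
  by have := hn n (leqnn n); rewrite /= cnE ltcR => /ltW.
have h3 : cn (y - u n.+1) <= e / 2.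
  by have := hn n.+1 (leqnSn n); rewrite /= cnE ltcR => /ltW.
have -> : y - (h + h ** y) = (y - u n.+1) - h ** (y - u n).
  rewrite /= cs_mulBr -addrA -opprD; congr (_ - _).
  by rewrite addrA (addrAC h) addrK.
rewrite (le_trans (cnB _ _)) // [e]splitr lerD //.
rewrite (le_trans (cnM _ _)) // (le_trans _ h2) // -[leRHS]mul1r.
by rewrite ler_wpM2r ?cn_ge0 // ltW.
Qed.

End Neumann.

Section Contractive.
Variables (R : realType) (Y : choiceType).
Local Notation B := (bop_cstar R Y).
Local Notation H := (l2 R (Y * bool)%type).
Implicit Types (T U : B) (f g : H).

Lemma cn_bop T : cn T = opn (T : bop R Y). Proof. by []. Qed.

Lemma cs_bopD T U f : (T + U : bop R Y) f = (T : bop R Y) f + (U : bop R Y) f.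
Proof. exact: bopD. Qed.
Lemma cs_bopZ (a : R[i]) T f : (a *: T : bop R Y) f = cscale a ((T : bop R Y) f).
Proof. exact: bopZ. Qed.
Lemma cs_bop_adj T f g :
  ip ((T : bop R Y) f) g = ip f ((T^# : bop R Y) g).
Proof. exact: bop_adjP. Qed.

Lemma cscale_real (r : R) f : cscale r%:C f = r *: f.
Proof. by rewrite /cscale /= scale0r addr0. Qed.

Variables (A : cstar_alg R) (pi : A -> B).
Hypothesis hpi : star_hom pi.

Lemma star_homD x y : pi (x + y) = pi x + pi y.
Proof.
by have [l _ _] := hpi; have := l 1 x y; rewrite !scale1r.
Qed.
Lemma star_hom0 : pi 0 = 0.
Proof. by apply: (@addrI _ (pi 0)); rewrite -star_homD !addr0. Qed.
Lemma star_homZ a x : pi (a *: x) = a *: pi x.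
Proof.
by have [l _ _] := hpi; have := l a x 0; rewrite star_hom0 !addr0.
Qed.
Lemma star_homB x y : pi (x - y) = pi x - pi y.
Proof. by rewrite star_homD -scaleN1r star_homZ scaleN1r. Qed.

(* If [opn (pi x) = t > cn x], then [1 - x^# x / t^2] has a left inverse, hence
   so has [1 - z^# z / t^2] with [z = pi x]; but vectors nearly attaining the
   norm of [z] are nearly annihilated by the latter. *)
Lemma star_hom_contractive x : cn (pi x) <= cn x.
Proof.
rewrite leNgt; apply/negP => hlt.
set z := pi x in hlt; set t := cn z in hlt.
have t0 : 0 < t by rewrite (le_lt_trans _ hlt) ?cn_ge0.
have t2 : 0 < t ^+ 2 by rewrite exprn_gt0.
have ti : 0 <= (t ^+ 2)^-1 by rewrite invr_ge0 ltW.
pose h := ((t ^+ 2)^-1)%:C *: (x^# ** x).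
have hs : h^# = h.
  rewrite /h cs_starZ cs_starM cs_starK; congr (_ *: _).
  by apply/eqP; rewrite eq_complex /= oppr0 !eqxx.
have h1 : cn h < 1.
  rewrite /h cnZr ger0_norm // cn_starM ltr_pdivrMl // mulr1.
  by rewrite ltr_pXn2r ?nnegrE ?cn_ge0 // ltW.
have [y yE] := neumann h1.
(* As h is self-adjoint, the adjoint turns the right inverse 1 + y of 1 - h into a left inverse 1 +
   y^#. *)
have yE' : y^# = h + y^# ** h by rewrite {1}yE cs_starD cs_starM hs.
pose w := pi y^#; pose G := pi h.
have GE : G = ((t ^+ 2)^-1)%:C *: (z^# ** z).
  by rewrite /G /h star_homZ; have [_ -> ->] := hpi.
have wE : w = G + w ** G.
  by rewrite /w {1}yE' star_homD; have [_ -> _] := hpi.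
pose c := 1 + cn w; have c1 : 1 <= c by rewrite lerDl cn_ge0.
have c0 : 0 < c by rewrite (lt_le_trans _ c1).
have Gf f : (G : bop R Y) f = (t ^+ 2)^-1 *: (z^# : bop R Y) ((z : bop R Y) f).
  by rewrite GE cs_bopZ cscale_real cs_mulE.
(* The left inverse 1 + w of 1 - G gives |f| <= c |f - G f|. Expanding the square, with |G f| <= |f|
   and <f, G f> = |z f|^2 / t^2, bounds |z f|^2 by a factor strictly below t^2, although t is the
   norm of z. *)
have key f : ip ((z : bop R Y) f) ((z : bop R Y) f) <=
    (t ^+ 2 * (1 - (2 * c ^+ 2)^-1)) * ip f f.
  have n1 : l2n f <= c * l2n (f - (G : bop R Y) f).
    have e1 : f = (f - (G : bop R Y) f) + (w : bop R Y) (f - (G : bop R Y) f).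
      have e2 : (w : bop R Y) f =
          (G : bop R Y) f + (w : bop R Y) ((G : bop R Y) f).
        by have := congr1 (fun T : B => (T : bop R Y) f) wE; rewrite cs_bopD cs_mulE.
      have e3 : (w : bop R Y) (f - (G : bop R Y) f) =
          (w : bop R Y) f - (w : bop R Y) ((G : bop R Y) f) := linearB _ _ _.
      by rewrite e3 e2 addrK subrK.
    rewrite {1}e1 (le_trans (l2nD _ _)) // mulrDl mul1r lerD // cn_bop.
    exact: opnP.
  have n2 : ip f f <= c ^+ 2 * ip (f - (G : bop R Y) f) (f - (G : bop R Y) f).
    rewrite -!sqr_l2n -exprMn ler_pXn2r ?nnegrE ?mulr_ge0 ?l2n_ge0 //.
    exact: ltW.
  have n3 : ip ((G : bop R Y) f) ((G : bop R Y) f) <= ip f f.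
    rewrite -!sqr_l2n ler_pXn2r ?nnegrE ?l2n_ge0 //.
    rewrite (le_trans (opnP _ _)) // -cn_bop GE cnZr ger0_norm // cn_starM.
    by rewrite -/t mulVf ?mul1r // gt_eqF.
  have n4 : ip f ((G : bop R Y) f) =
      (t ^+ 2)^-1 * ip ((z : bop R Y) f) ((z : bop R Y) f).
    by rewrite Gf ipZr -cs_bop_adj.
  move: n2; rewrite ipBl !ipBr (ipC _ f) n4.
  move: n3; set P := ip f f; set Q := ip _ _; set S := ip _ _ => n3 n2.
  have c2 : 0 < c ^+ 2 by rewrite exprn_gt0.
  have n5 : P <= c ^+ 2 * (2 * P - 2 * ((t ^+ 2)^-1 * S)).
    rewrite (le_trans n2) // ler_pM2l //; lra.
  have n6 : (2 * c ^+ 2)^-1 * P <= P - (t ^+ 2)^-1 * S.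
    by rewrite ler_pdivrMl ?mulr_gt0 //; lra.
  rewrite -mulrA -ler_pdivrMl // mulrBl mul1r; lra.
have d0 : 0 < (2 * c ^+ 2)^-1 by rewrite invr_gt0 mulr_gt0 // exprn_gt0.
have d1 : (2 * c ^+ 2)^-1 <= 1.
  rewrite invf_le1 ?mulr_gt0 ?exprn_gt0 //.
  have c2 : 1 <= c ^+ 2 by rewrite exprn_ege1.
  by lra.
set M := t ^+ 2 * (1 - (2 * c ^+ 2)^-1) in key.
have M0 : 0 <= M by rewrite mulr_ge0 ?(ltW t2) ?subr_ge0.
have : t <= Num.sqrt M.
  rewrite /t cn_bop; apply: opn_le => [|f]; first exact: sqrtr_ge0.
  by rewrite /l2n -sqrtrM // ler_wsqrtr.
rewrite -(@ler_pXn2r _ 2) ?nnegrE ?sqrtr_ge0 ?(ltW t0) // sqr_sqrtr // /M.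
rewrite -subr_le0; rewrite [X in X <= 0](_ : _ = t ^+ 2 * (2 * c ^+ 2)^-1); last by ring.
by rewrite leNgt mulr_gt0.
Qed.

End Contractive.

(** * The span of the s_f s_g^* *)

Lemma zmod_shift (V : zmodType) (a b c d p q : V) :
  b + q = d + p -> a + p - (c + q) = a - d + (b - c).
Proof.
move=> e; have -> : a + p - (c + q) = a + (p - q) - c.
  by rewrite opprD addrA -addrA [- c - q]addrC !addrA.
have -> : p - q = b - d.
  by apply/eqP; rewrite subr_eq addrAC -subr_eq opprK e addrC.
by rewrite (addrC b) !addrA.
Qed.

Section CuntzKrieger.
Variables (R : realType) (L : Ngraph) (A : cstar_alg R) (s : mor L -> A).
Hypotheses (L_row_finite : row_finite L) (hs : CK_family s).
Implicit Types (f g h : mor L) (v w : vertex L) (m n : degree) (x y : A).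

Lemma ck_idl f : s (idm (rng f)) ** s f = s f.
Proof. by rewrite (CK2_comp hs) ?src_idm // comp_idl. Qed.

Lemma ck_idr f : s f ** s (idm (src f)) = s f.
Proof. by rewrite (CK2_comp hs) ?rng_idm // comp_idr. Qed.

Lemma ck_adj_idr f : (s f)^# ** s (idm (rng f)) = (s f)^#.
Proof. by rewrite -[in RHS](ck_idl f) cs_starM (CK1_proj hs _).1. Qed.

Lemma ck_adj_idl f : s (idm (src f)) ** (s f)^# = (s f)^#.
Proof. by rewrite -[in RHS](ck_idr f) cs_starM (CK1_proj hs _).1. Qed.

Lemma ck_vertex_proj v : is_proj (s (idm v)).
Proof. exact: CK1_proj. Qed.

Lemma ck_range_proj f : is_proj (s f ** (s f)^#).
Proof.
split; first by rewrite cs_starM cs_starK.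
by rewrite cs_mulA (CK_partial_isometry hs).
Qed.

Lemma cn_ck f : cn (s f) <= 1.
Proof.
rewrite -(@expr_le1 _ 2) ?cn_ge0 // -cn_starM (CK3 hs).
exact: cn_proj (ck_vertex_proj _).
Qed.

Definition vpaths v n : {fset mor L} := fset_set (paths_from v n).

Lemma in_vpaths v n f : f \in vpaths v n <-> rng f = v /\ deg f = n.
Proof.
rewrite /vpaths (in_fset_set (L_row_finite v n)); split.
  by rewrite inE.
by move=> h; rewrite inE.
Qed.

Lemma ck_sum v n : s (idm v) = \sum_(f <- vpaths v n) s f ** (s f)^#.
Proof. by rewrite (CK4 hs v n) fsbig_finite //; exact: L_row_finite. Qed.

(** With different ranges this is CK1. With the same range both range projections occur in one CK4
    sum, so [sum_proj_orth] applies. *)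
Lemma ck_orth f g : deg f = deg g -> f <> g -> (s f)^# ** s g = 0.
Proof.
move=> dfg fg; have [rfg|rfg] := eqVneq (rng f) (rng g); last first.
  rewrite -ck_adj_idr -(ck_idl g) -cs_mulA (cs_mulA (s (idm (rng f)))).
  by rewrite (CK1_orth hs) ?cs_mul0l ?cs_mul0r //; exact/eqP.
pose S := vpaths (rng f) (deg f).
have fS : f \in S by apply/in_vpaths.
have gS : g \in S by apply/in_vpaths.
have := @sum_proj_orth R A _ S (fun h => s h ** (s h)^#) _
  (ck_vertex_proj (rng f)) (fun h _ => ck_range_proj h) _ (ck_sum _ _) f g fS gS.
have hP : forall h, h \in S ->
    s (idm (rng f)) ** (s h ** (s h)^#) = s h ** (s h)^#.
  by move=> h /in_vpaths[<- _]; rewrite cs_mulA ck_idl.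
move=> /(_ hP); have nfg : f != g by apply/eqP.
move=> /(_ nfg) h0.
rewrite -[s f](CK_partial_isometry hs) -[s g](CK_partial_isometry hs).
rewrite !cs_starM cs_starK -!cs_mulA.
rewrite (cs_mulA (s f) (s f)^#) (cs_mulA (s g) (s g)^#).
by rewrite (cs_mulA (s f ** _)) h0 cs_mul0l cs_mul0r.
Qed.

Lemma ck_adj_mul g h : (deg g `<=` deg h)%mset ->
  (s g)^# ** s h = if init h (deg g) == g then s (rest h (deg g)) else 0.
Proof.
move=> /split_atP[h1 h2 h3]; rewrite {1}h2 -(CK2_comp hs) // cs_mulA.
case: eqP => [e|ne].
  by rewrite {1}e (CK3 hs) -{1}e h1 ck_idl.
by rewrite ck_orth ?cs_mul0l // => e; apply: ne.
Qed.

(** The predicate on pairs of paths lets the same closure lemmas serve homogeneous elements,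
    fixed-degree cores, the corner and the whole span. *)
Inductive ck_span (P : mor L -> mor L -> Prop) : A -> Prop :=
| ck_span0 : ck_span P 0
| ck_spanD x y : ck_span P x -> ck_span P y -> ck_span P (x + y)
| ck_span_gen c f g : P f g -> ck_span P (c *: (s f ** (s g)^#)).

Lemma ck_span_gen1 (P : mor L -> mor L -> Prop) f g :
  P f g -> ck_span P (s f ** (s g)^#).
Proof. by move=> h; rewrite -[_ ** _]scale1r; exact: ck_span_gen. Qed.

Lemma ck_span_sub (P Q : mor L -> mor L -> Prop) x :
  (forall f g, P f g -> Q f g) -> ck_span P x -> ck_span Q x.
Proof.
move=> PQ; elim=> [|? ? _ ? _ ?|c f g Pfg]; first exact: ck_span0.
  exact: ck_spanD.
by apply: ck_span_gen; exact: PQ.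
Qed.

Lemma ck_span_scale P c x : ck_span P x -> ck_span P (c *: x).
Proof.
elim=> [|? ? _ h1 _ h2|c' f g Pfg]; first by rewrite scaler0; exact: ck_span0.
  by rewrite scalerDr; exact: ck_spanD.
by rewrite scalerA; exact: ck_span_gen.
Qed.

Lemma ck_span_sum P (I : eqType) (r : seq I) (Q : pred I) (F : I -> A) :
  (forall i, i \in r -> Q i -> ck_span P (F i)) ->
  ck_span P (\sum_(i <- r | Q i) F i).
Proof.
move=> h; rewrite big_seq_cond; apply: big_ind => [|x y|i /andP[]].
- exact: ck_span0.
- exact: ck_spanD.
- exact: h.
Qed.

Lemma ck_span_star (P Q : mor L -> mor L -> Prop) x :
  (forall f g, P f g -> Q g f) -> ck_span P x -> ck_span Q x^#.
Proof.
move=> PQ; elim=> [|? ? _ h1 _ h2|c f g Pfg].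
- by rewrite cs_star0; exact: ck_span0.
- by rewrite cs_starD; exact: ck_spanD.
- rewrite cs_starZ cs_starM cs_starK; apply: ck_span_gen; exact: PQ.
Qed.

Lemma ck_span_mul (P Q S : mor L -> mor L -> Prop) x y :
  (forall f g f' g', P f g -> Q f' g' ->
    ck_span S ((s f ** (s g)^#) ** (s f' ** (s g')^#))) ->
  ck_span P x -> ck_span Q y -> ck_span S (x ** y).
Proof.
move=> h; elim=> [|x1 x2 _ h1 _ h2|c f g Pfg] hy.
- by rewrite cs_mul0l; exact: ck_span0.
- by rewrite cs_mulDl; apply: ck_spanD; [exact: h1 | exact: h2].
- elim: hy => [|y1 y2 _ h1 _ h2|c' f' g' Qfg].
  + by rewrite cs_mul0r; exact: ck_span0.
  + by rewrite cs_mulDr; exact: ck_spanD.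
  + rewrite cs_scalel cs_scaler; do 2!apply: ck_span_scale; exact: h.
Qed.

Definition zdeg f g : nat -> int := dz (deg f) - dz (deg g).

(* [(s g)^# s f'] is expanded over the paths of degree [deg g \/ deg f']. *)
Lemma ck_gen_mul f g f' g' : src f = src g -> src f' = src g' ->
  ck_span (fun F G => [/\ rng F = rng f, rng G = rng g', src F = src G &
                         zdeg F G = zdeg f g + zdeg f' g'])
    ((s f ** (s g)^#) ** (s f' ** (s g')^#)).
Proof.
move=> sfg sfg'; have [rr|rr] := eqVneq (rng g) (rng f'); last first.
  have -> : (s f ** (s g)^#) ** (s f' ** (s g')^#) = 0; last exact: ck_span0.
  rewrite -(ck_adj_idr g) -(ck_idl f') -!cs_mulA (cs_mulA (s (idm _)) (s (idm _))).
  by rewrite (CK1_orth hs) ?cs_mul0l ?cs_mul0r //; exact/eqP.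
set q := (deg g `|` deg f')%mset.
have -> : (s f ** (s g)^#) ** (s f' ** (s g')^#) =
    \sum_(h <- vpaths (rng g) q)
      (s f ** ((s g)^# ** s h)) ** (((s f')^# ** s h)^# ** (s g')^#).
  transitivity ((s f ** ((s g)^# ** s (idm (rng g)))) ** (s f' ** (s g')^#)).
    by rewrite ck_adj_idr.
  rewrite (ck_sum (rng g) q) cs_mul_sumr cs_mul_sumr cs_mul_suml.
  by apply: eq_bigr => h _; rewrite cs_starM cs_starK !cs_mulA.
apply: ck_span_sum => h /in_vpaths[rh dh] _.
have hg : (deg g `<=` deg h)%mset by rewrite dh msubsetUl.
have hf : (deg f' `<=` deg h)%mset by rewrite dh msubsetUr.
rewrite !ck_adj_mul //.
case: eqP => [eg|_]; last by rewrite cs_mul0r cs_mul0l; exact: ck_span0.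
case: eqP => [ef|_]; last by rewrite cs_star0 cs_mul0l cs_mul0r; exact: ck_span0.
have [a1 a2 a3] := split_atP hg; have [b1 b2 b3] := split_atP hf.
rewrite eg in a1 a2; rewrite ef in b1 b2.
rewrite -cs_starM !(CK2_comp hs) -?sfg' ?sfg //; apply: ck_span_gen1.
split; rewrite ?rng_comp ?src_comp -?sfg' ?sfg //.
  by rewrite -(src_comp a1) -a2 {1}b2 src_comp.
rewrite /zdeg !deg_comp -?sfg' ?sfg // !dzD.
have : dz (deg h) = dz (deg g) + dz (deg (rest h (deg g))).
  by rewrite {1}a2 deg_comp // dzD.
have : dz (deg h) = dz (deg f') + dz (deg (rest h (deg f'))).
  by rewrite {1}b2 deg_comp // dzD.
by move=> -> e; apply: (zmod_shift (dz (deg f)) (dz (deg g')) e).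
Qed.

Definition homog v (k : nat -> int) := ck_span (fun f g =>
  [/\ rng f = v, rng g = v, src f = src g & zdeg f g = k]).

Lemma homog_mul v k l x y : homog v k x -> homog v l y -> homog v (k + l) (x ** y).
Proof.
apply: ck_span_mul => f g f' g' [rf rg sfg e] [rf' rg' sfg' e'].
apply: ck_span_sub (ck_gen_mul sfg sfg') => F G [-> -> ? ->].
by rewrite rf rg' e e'.
Qed.

Lemma homog_star v k x : homog v k x -> homog v (- k) x^#.
Proof.
by apply: ck_span_star => f g [? ? ? <-]; split=> //; rewrite /zdeg opprB.
Qed.

(** Its generators multiply like matrix units indexed by the finitely many paths of degree [m] from
    [v], grouped by source; hence a finite-dimensional *-algebra. *)
Definition core v m := ck_span (fun f g =>
  [/\ f \in vpaths v m, g \in vpaths v m & src f = src g]).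

(** CK4 at the common source refines s_f s_g^# into the sum of s_{fh} s_{gh}^# over h of degree n -
    m, so the cores are directed. *)
Lemma core_le v m n x : (m `<=` n)%mset -> core v m x -> core v n x.
Proof.
move=> mn; elim=> [|? ? _ h1 _ h2|c f g [/in_vpaths[rf df] /in_vpaths[rg dg] sfg]].
- exact: ck_span0.
- exact: ck_spanD.
apply: ck_span_scale; rewrite -(ck_idr f) (ck_sum (src f) (n `\` m)%mset).
rewrite cs_mul_sumr cs_mul_suml; apply: ck_span_sum => h /in_vpaths[rh dh] _.
rewrite cs_mulA (CK2_comp hs) // -cs_mulA -cs_starM (CK2_comp hs) -?sfg //.
apply: ck_span_gen1; split; last by rewrite !src_comp -?sfg.
  by apply/in_vpaths; rewrite rng_comp // deg_comp // df dh msetDBK.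
by apply/in_vpaths; rewrite rng_comp -?sfg // deg_comp -?sfg // dg dh msetDBK.
Qed.

Lemma homog0_core v x : homog v 0 x -> exists m, core v m x.
Proof.
elim=> [|x1 x2 _ [m1 h1] _ [m2 h2]|c f g [rf rg sfg]].
- by exists mset0; exact: ck_span0.
- exists (m1 `|` m2)%mset; apply: ck_spanD.
    by apply: core_le h1; rewrite msubsetUl.
  by apply: core_le h2; rewrite msubsetUr.
- move=> /eqP; rewrite subr_eq0 => /eqP/dz_inj dfg.
  by exists (deg f); apply: ck_span_gen; split=> //; apply/in_vpaths.
Qed.

Lemma core_mul v m x y : core v m x -> core v m y -> core v m (x ** y).
Proof.
apply: ck_span_mul => f g f' g' [hf hg sfg] [hf' hg' sfg'].
rewrite -cs_mulA (cs_mulA (s g)^#).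
have [gf'|/eqP gf'] := eqVneq g f'; last first.
  rewrite ck_orth ?cs_mul0l ?cs_mul0r //; first exact: ck_span0.
  by move: hg hf' => /in_vpaths[_ ->] /in_vpaths[_ ->].
rewrite gf' (CK3 hs) sfg' ck_adj_idl; apply: ck_span_gen1; split=> //.
by rewrite sfg gf'.
Qed.

Lemma core_normal_form v m x : core v m x -> exists c : mor L -> mor L -> R[i],
  x = \sum_(f <- vpaths v m) \sum_(g <- vpaths v m) c f g *: (s f ** (s g)^#).
Proof.
elim=> [|x1 x2 _ [c1 h1] _ [c2 h2]|c f g [hf hg sfg]].
- exists (fun _ _ => 0); rewrite big1 // => f _.
  by rewrite big1 // => g _; rewrite scale0r.
- exists (fun f g => c1 f g + c2 f g); rewrite h1 h2 -big_split.
  apply: eq_bigr => f _; rewrite -big_split.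
  by apply: eq_bigr => g _; rewrite scalerDl.
- exists (fun f' g' => if (f' == f) && (g' == g) then c else 0).
  rewrite (big_fsetD1 f) //= (big_fsetD1 g) //= !eqxx /=.
  rewrite [X in _ + X + _]big1_seq ?addr0 ?[X in _ + X]big1_seq ?addr0 //.
    move=> f' /=; rewrite !inE => /andP[/negbTE -> _].
    by rewrite big1 // => g' _; rewrite scale0r.
  by move=> g' /=; rewrite !inE => /andP[/negbTE -> _]; rewrite scale0r.
Qed.

Lemma cn_ck_gen f g : cn (s f ** (s g)^#) <= 1.
Proof. by apply: cnM_le1; rewrite ?cn_star cn_ck. Qed.

Lemma ck_gen_eq0 f g : src f <> src g -> s f ** (s g)^# = 0.
Proof.
move=> fg; rewrite -(ck_idr f) -(ck_adj_idl g) -cs_mulA.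
by rewrite (cs_mulA (s (idm _))) (CK1_orth hs) // cs_mul0l cs_mul0r.
Qed.

End CuntzKrieger.

(** * Norm estimates by powers *)

Section PowerTrick.
Variable R : realType.

(** If M < t, put u = M / t < 1. The hypothesis keeps (2^j + 1)^r u^(2^j) away from 0, but passing
    from j to j + 1 multiplies this by at most 2^r u^(2^j), which is eventually below 1/2. *)
Lemma le_of_pow2_le (t M C : R) r : 0 <= t -> 0 <= M ->
  (forall j, t ^+ (2 ^ j) <= C * (2 ^ j).+1%:R ^+ r * M ^+ (2 ^ j)) -> t <= M.
Proof.
move=> t0 M0 h; rewrite leNgt; apply/negP => Mt.
have tp : 0 < t by rewrite (le_lt_trans M0).
pose u := M / t; have u0 : 0 <= u by rewrite divr_ge0.
have u1 : u < 1 by rewrite ltr_pdivrMr ?mul1r.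
pose b j : R := (2 ^ j).+1%:R ^+ r * u ^+ (2 ^ j).
have b0 j : 0 <= b j by rewrite mulr_ge0 ?exprn_ge0.
have hb j : 1 <= C * b j.
  rewrite /b /u expr_div_n !mulrA ler_pdivlMr ?exprn_gt0 // mul1r; exact: h.
have bS j : b j.+1 <= b j * (2 ^+ r * u ^+ (2 ^ j)).
  rewrite /b expnS mul2n -addnn exprD mulrACA.
  rewrite !mulrA ler_wpM2r ?exprn_ge0 // ler_wpM2r ?exprn_ge0 // -exprMn.
  rewrite lerXn2r ?nnegrE ?mulr_ge0 // -natrM ler_nat; lia.
(* This n makes the factor 2^r u^n less than 1/2, and 2^j >= n for all j >= n. *)
have [n hn] : exists n, u ^+ n < (2 * 2 ^+ r)^-1.
  by apply: expr_small => //; rewrite invr_gt0 mulr_gt0 ?exprn_gt0.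
have hj j : (n <= j)%N -> 2 ^+ r * u ^+ (2 ^ j) <= 2^-1.
  move=> nj; rewrite mulrC -ler_pdivlMr ?exprn_gt0 // -invfM.
  apply: le_trans (ltW hn); apply: ler_wiXn2l => //; first exact: ltW.
  by rewrite (leq_trans nj) // ltnW // ltn_expl.
have hi i : b (n + i)%N <= b n * 2^-1 ^+ i.
  elim: i => [|i IHi]; first by rewrite addn0 expr0 mulr1.
  rewrite addnS (le_trans (bS _)) // exprSr [leRHS]mulrA ler_pM //.
    by rewrite mulr_ge0 ?exprn_ge0.
  by apply: hj; rewrite leq_addr.
have C0 : 0 < C.
  have := hb n; rewrite ltNge => h1; apply/negP => C0.
  by have := le_trans h1 (mulr_le0_ge0 C0 (b0 n)); rewrite leNgt ltr01.
have bn : 0 < b n.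
  have := hb n => h1; rewrite lt_neqAle b0 andbT eq_sym; apply/eqP => e.
  by move: h1; rewrite e mulr0 leNgt ltr01.
have [i hi'] : exists i, (2^-1 : R) ^+ i < (C * b n)^-1.
  by apply: expr_small; rewrite ?invr_ge0 ?invf_lt1 ?ltr1n // invr_gt0 mulr_gt0.
have Cb : 0 < C * b n by rewrite mulr_gt0.
have h1 : C * b n * 2^-1 ^+ i < 1 by move: hi'; rewrite -(ltr_pM2l Cb) mulfV ?gt_eqF.
have := le_trans (hb (n + i)%N) (ler_wpM2l (ltW C0) (hi i)).
by rewrite mulrA leNgt h1.
Qed.

Variable A : cstar_alg R.

(** The algebra has no unit, so the indexing starts at the first power: [cs_pow a n] is a^(n+1). *)
Definition cs_pow (a : A) n := iter n (cs_mul a) a.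

Lemma cs_powD a m n : cs_pow a m ** cs_pow a n = cs_pow a (m + n).+1.
Proof. by elim: m => [//|m IHm]; rewrite /= -cs_mulA IHm. Qed.

Lemma cs_pow_star a n : a^# = a -> (cs_pow a n)^# = cs_pow a n.
Proof.
move=> aa; elim: n => [//|n IHn] /=; rewrite cs_starM IHn aa.
by rewrite -[a in X in X = _]/(cs_pow a 0) cs_powD addn0.
Qed.

Lemma cn_cs_pow2 a j : a^# = a -> cn (cs_pow a (2 ^ j).-1) = cn a ^+ (2 ^ j).
Proof.
move=> aa; elim: j => [|j IHj]; first by rewrite expn0 expr1.
rewrite expnS mulnC exprM -IHj -cn_starM cs_pow_star // cs_powD.
congr (cn (cs_pow a _)); have := expn_gt0 2 j; lia.
Qed.

Lemma cn_le_of_pow (a : A) M C r : a^# = a -> 0 <= M ->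
  (forall n, cn (cs_pow a n) <= C * n.+2%:R ^+ r * M ^+ n.+1) -> cn a <= M.
Proof.
move=> aa M0 h; apply: (@le_of_pow2_le _ _ C r) => // [|j]; first exact: cn_ge0.
rewrite -cn_cs_pow2 // (le_trans (h _)) //.
by rewrite prednK ?expn_gt0.
Qed.

End PowerTrick.

(** * Lower bounds for the representation on homogeneous elements *)

Section GradedBounds.
Variables (R : realType) (L : Ngraph) (H : set (vertex L)).
Hypotheses (L_row_finite : row_finite L) (H_hered : hereditary H).
Variables (A : cstar_alg R) (s : mor L -> A).
Hypothesis hs : CK_family s.
Local Notation Y := ((degree -> mor L) * (nat -> int))%type.
Local Notation B := (bop_cstar R Y).
Local Notation l2Y := (l2 R (Y * bool)%type).
Variable pi : A -> B.
Hypotheses (hpi : star_hom pi) (pi_s : forall f, pi (s f) = path_rep R H_hered f).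
Implicit Types (f g : mor L) (v : vertex L) (a x : A) (xi : l2Y).

Definition act a xi : l2Y := (pi a : bop R Y) xi.

Lemma actD a x xi : act (a + x) xi = act a xi + act x xi.
Proof. by rewrite /act (star_homD hpi) cs_bopD. Qed.
Lemma act0 xi : act 0 xi = 0.
Proof. by rewrite /act (star_hom0 hpi); exact: bop0E. Qed.
Lemma actZ c a xi : act (c *: a) xi = cscale c (act a xi).
Proof. by rewrite /act (star_homZ hpi) cs_bopZ. Qed.
Lemma actM a x xi : act (a ** x) xi = act a (act x xi).
Proof. by rewrite /act; case: hpi => _ -> _; rewrite cs_mulE. Qed.
Lemma act_le a xi : l2n (act a xi) <= cn (pi a) * l2n xi.
Proof. exact: opnP. Qed.
Lemma act_s f xi y b : act (s f) xi (y, b) = oapp (fun y' => xi (y', b)) 0 (del H f y).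
Proof. by rewrite /act pi_s path_repE. Qed.
Lemma act_adj f xi y b :
  act (s f)^# xi (y, b) = oapp (fun y' => xi (y', b)) 0 (ins H f y).
Proof. by rewrite /act; case: hpi => _ _ ->; rewrite pi_s path_rep_adjE. Qed.

Lemma act_sum (I : Type) (r : seq I) (F : I -> A) xi z :
  act (\sum_(i <- r) F i) xi z = \sum_(i <- r) act (F i) xi z.
Proof.
by elim/big_ind2: _ => [|? ? ? ? <- <-|//]; rewrite ?act0 ?actD.
Qed.

Definition on_grade (j : nat -> int) xi :=
  forall (x : degree -> mor L) (k : nat -> int) (b : bool),
    k <> j -> xi ((x, k), b) = 0.

Lemma on_grade_s j f xi : on_grade j xi -> on_grade (j + dz (deg f)) (act (s f) xi).
Proof.
move=> hxi x k b kj; rewrite act_s /del /=; case: asboolP => //= _; apply: hxi => e.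
by apply: kj; rewrite -e subrK.
Qed.

Lemma on_grade_adj j f xi :
  on_grade j xi -> on_grade (j - dz (deg f)) (act (s f)^# xi).
Proof.
move=> hxi x k b kj; rewrite act_adj /ins /=; case: asboolP => //= _; apply: hxi => e.
by apply: kj; rewrite -e addrK.
Qed.

Lemma homog_grade v k x j xi : homog s v k x -> on_grade j xi ->
  on_grade (j + k) (act x xi).
Proof.
move=> hx hxi; elim: hx => [|x1 x2 _ h1 _ h2|c f g [_ _ _ <-]] y l b jl.
- by rewrite act0.
- by rewrite actD l2D h1 // h2 // addr0.
- rewrite actZ actM /cscale l2D !l2Z JopE.
  have h : on_grade (j + zdeg f g) (act (s f) (act (s g)^# xi)).
    rewrite /zdeg addrCA addrC; apply: on_grade_s; exact: on_grade_adj.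
  by rewrite !h // !mulr0 add0r; case: b; rewrite ?oppr0 mulr0.
Qed.

(** Only vectors of grade 0 are tested. Elements of degree 0 preserve them, so these bounds
    multiply; and on a vector of a single grade a homogeneous component is dominated by the whole
    sum. *)
Definition bound0 a M := forall xi, on_grade 0 xi -> l2n (act a xi) <= M * l2n xi.

(* Equivalently, the paths entering H are dense among the infinite paths starting
   at v. *)
Definition reaches v :=
  forall f, rng f = v -> exists2 g, rng g = src f & H (src g).

Hypothesis L_no_sources : no_sources L.

Lemma entering_path f v : reaches v -> rng f = v ->
  exists2 y, enters H y & rng (y mset0) = src f.
Proof.
move=> /(_ f) h /h [g rg hg]; have [y hy yg] := ipath_exists L_no_sources g.
exists y; last by rewrite -(rng_ipath (deg g) hy) yg.
by split=> //; exists (deg g); rewrite yg.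
Qed.

Lemma point_mass (z : Y) : exists2 xi : l2Y, l2n xi <= 1 &
  forall z' b, xi (z', b) = if (z' == z) && ~~ b then 1 else 0.
Proof.
pose fn (w : Y * bool) : R := if (w.1 == z) && ~~ w.2 then 1 else 0.
have hsum (F : {fset Y * bool}) : \sum_(w <- F) fn w ^+ 2 <= 1.
  have h0 w : w != (z, false) -> fn w ^+ 2 = 0.
    rewrite /fn; case: w => w [] /=; rewrite ?andbF ?expr0n // andbT.
    by rewrite xpair_eqE andbT => /negbTE ->; rewrite expr0n.
  have [zF|zF] := boolP ((z, false) \in F).
    rewrite (big_fsetD1 _ zF) /= big1_seq ?addr0.
      by rewrite /fn /= eqxx /= expr1n.
    by move=> w /=; rewrite !inE => /andP[w0 _]; exact: h0.
  rewrite big1_seq ?ler01 // => w /= wF; apply: h0.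
  by apply: contraNneq zF => <-.
have hfn : fn \in @l2_pred R (Y * bool)%type by apply/asboolP; exists 1.
by exists (MkL2 hfn) => //; apply: l2n_le => // F; rewrite expr1n; exact: hsum.
Qed.

(** The coefficient is a matrix entry of the representation: with y a path entering H from the
    common source, apply the element to the point mass at g0 y and read the coordinate at f0 y. Both
    points have degree component 0. *)
Lemma coefficient_bound v m (c : mor L -> mor L -> R[i]) M f0 g0 : reaches v ->
  bound0 (\sum_(f <- vpaths v m) \sum_(g <- vpaths v m) c f g *: (s f ** (s g)^#)) M ->
  f0 \in vpaths v m -> g0 \in vpaths v m -> src f0 = src g0 ->
  0 <= M -> complex.Re `|c f0 g0| <= M.
Proof.
move=> hv; set x := \sum_(f <- _) _ => hx fv gv fg M0.
have /(in_vpaths L_row_finite)[rf df] := fv.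
have /(in_vpaths L_row_finite)[rg dg] := gv.
have [y hy yf] := entering_path hv rf.
have yg : rng (y mset0) = src g0 by rewrite yf.
pose w : Y := (prepend g0 y, 0); pose z : Y := (prepend f0 y, 0).
have [xi xi1 xiE] := point_mass w.
have gr : on_grade 0 xi.
  by move=> y' k b k0; rewrite xiE; case: eqP => [[_ /k0]|].
have gen f g b : f \in vpaths v m -> g \in vpaths v m ->
    act (s f ** (s g)^#) xi (z, b) = if [&& f == f0, g == g0 & ~~ b] then 1 else 0.
  move=> /(in_vpaths L_row_finite)[rf' df'] /(in_vpaths L_row_finite)[rg' dg'].
  rewrite actM act_s /del /=.
  have -> : prepend f0 y (deg f) = f0.
    by rewrite df' -df prepend_init //; case: hy.
  have ez : enters H (prepend f0 y) by exact: enters_prepend.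
  case: asboolP => [[_ ff]|nf]; last first.
    by case: eqP => // e; case: nf; split.
  rewrite -ff eqxx /= act_adj /ins /= shift_prepend //; last by case: hy.
  case: asboolP => [[_ gg]|ng] /=.
    rewrite xiE xpair_eqE sub0r df dg' addNr eqxx andbT.
    congr (if _ && _ then _ else _); apply/eqP/eqP => [e|->//].
    have := congr1 (@^~ m) e; rewrite -{1}dg' -dg.
    by rewrite !prepend_init //; case: hy.
  by case: eqP => // e; case: ng; rewrite e.
have val b : act x xi (z, b) =
    if b then complex.Im (c f0 g0) else complex.Re (c f0 g0).
  rewrite act_sum (big_fsetD1 _ fv) /= [X in _ + X]big1_seq ?addr0.
    rewrite act_sum (big_fsetD1 _ gv) /= [X in _ + X]big1_seq ?addr0.
      rewrite actZ /cscale l2D !l2Z JopE !gen // !eqxx /=.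
      by case: b => /=; rewrite ?oppr0 ?mulr0 ?mulr1 ?addr0 ?add0r.
    move=> g /=; rewrite !inE => /andP[/negbTE gg gv'].
    rewrite actZ /cscale l2D !l2Z JopE !gen // gg /= andbF.
    by case: b; rewrite ?oppr0 !mulr0 addr0.
  move=> f /=; rewrite !inE => /andP[/negbTE ff fv'].
  rewrite act_sum big1_seq // => g /= gv'.
  rewrite actZ /cscale l2D !l2Z JopE !gen // ff /=.
  by case: b; rewrite ?oppr0 !mulr0 addr0.
have hn : l2n (act x xi) <= M.
  by rewrite (le_trans (hx _ gr)) // ler_piMr.
(* The coordinates indexed by [false] and [true] are the real and imaginary parts, so |c f0 g0|^2 is
   a partial sum of the squared norm of [act x xi]. *)
rewrite normc_def /= (le_trans _ hn) // -[leRHS]ger0_norm ?l2n_ge0 //.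
rewrite -sqrtr_sqr ler_wsqrtr // (le_trans _ (l2n_sum _ [fset (z, false); (z, true)]%fset)) //.
rewrite big_fsetU1 ?big_seq_fset1 /= ?val //.
by rewrite !inE xpair_eqE andbF.
Qed.

Lemma cn_core_le v m x M : reaches v -> core s v m x -> bound0 x M -> 0 <= M ->
  cn x <= (size (vpaths v m) ^ 2)%:R * M.
Proof.
move=> hv /core_normal_form[c ->] hx M0.
rewrite (le_trans (cn_sum _ _ _)) //.
apply: (@le_trans _ _ (\sum_(f <- vpaths v m) \sum_(g <- vpaths v m) M)); last first.
  by rewrite !big_const_seq !count_predT !iter_addr_0 mulr_natl mulrnA.
rewrite big_seq [leRHS]big_seq; apply: ler_sum => f fv.
rewrite (le_trans (cn_sum _ _ _)) //.
rewrite big_seq [leRHS]big_seq; apply: ler_sum => g gv.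
have [e|/eqP e] := eqVneq (src f) (src g).
  rewrite cnZ -[leRHS]mulr1 ler_pM ?cn_ge0 ?Re_norm_ge0 ?cn_ck_gen //.
  exact: coefficient_bound hv hx fv gv e M0.
by rewrite ck_gen_eq0 // scaler0 cn0.
Qed.

Lemma bound0_mul v x a M N : homog s v 0 x -> bound0 a M -> bound0 x N ->
  0 <= M -> bound0 (a ** x) (M * N).
Proof.
move=> hx ha hx' M0 xi hxi; rewrite actM.
have := homog_grade hx hxi; rewrite addr0 => /ha /le_trans; apply.
by rewrite -mulrA ler_wpM2l // hx'.
Qed.

(** All powers of x stay in the same core, so the number of matrix entries, hence the constant of
    [cn_core_le], is the same for all of them. *)
Lemma cn_homog0_le v x M : reaches v -> homog s v 0 x -> x^# = x ->
  bound0 x M -> 0 <= M -> cn x <= M.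
Proof.
move=> hv hx xs hb M0; have [m hm] := homog0_core L_row_finite hs hx.
apply: (@cn_le_of_pow _ _ _ _ (size (vpaths v m) ^ 2)%:R 0) => // n.
rewrite expr0 mulr1.
have [p1 p2 p3] : [/\ core s v m (cs_pow x n), homog s v 0 (cs_pow x n) &
    bound0 (cs_pow x n) (M ^+ n.+1)].
  elim: n => [|n [h1 h2 h3]]; first by rewrite expr1.
  split; first exact: core_mul.
    by rewrite -[X in homog s v X _]addr0; apply: homog_mul.
  by rewrite exprS; apply: bound0_mul h2 hb h3 M0.
by apply: cn_core_le => //; rewrite exprn_ge0.
Qed.

(** Distinct components send [xi] to distinct grades, so the vector on the left is the restriction
    of the one on the right to a single grade. The map [phi] is the identity for the components and
    negation for their adjoints. *)
Lemma graded_component v (D : seq (nat -> int)) (phi : (nat -> int) -> nat -> int)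
    (X : (nat -> int) -> A) k0 j xi :
  uniq D -> injective phi -> (forall k, homog s v (phi k) (X k)) -> k0 \in D ->
  on_grade j xi -> l2n (act (X k0) xi) <= l2n (act (\sum_(k <- D) X k) xi).
Proof.
move=> uD iphi hX k0D hxi; apply: l2n_le => [|F]; first exact: l2n_ge0.
apply: le_trans (l2n_sum _ F); apply: ler_sum => -[[y l] b] _.
have [lk|lk] := eqVneq l (j + phi k0); last first.
  rewrite (homog_grade (hX k0) hxi); last exact/eqP.
  by rewrite expr0n sqr_ge0.
rewrite act_sum (big_rem k0) //= big1_seq ?addr0 // => k /= kD.
apply: (homog_grade (hX k) hxi); rewrite lk => /addrI/iphi e.
by move: kD; rewrite -e mem_rem_uniqF.
Qed.

(** With X = X k0 and c the sum, X^# X has degree 0. On a grade-0 vector, |X^# X xi| <= |c^# X xi|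
    <= |c| |X xi| <= |c|^2 |xi|, norms being taken after [pi]; the component is exchanged for the
    sum twice. *)
Lemma cn_component v D X k0 : reaches v -> uniq D ->
  (forall k, homog s v k (X k)) -> k0 \in D ->
  cn (X k0) <= cn (pi (\sum_(k <- D) X k)).
Proof.
move=> hv uD hX k0D; set c := \sum_(k <- D) X k.
have c0 : 0 <= cn (pi c) by exact: cn_ge0.
rewrite -(@ler_pXn2r _ 2) ?nnegrE ?cn_ge0 // -cn_starM.
have hXX : homog s v 0 ((X k0)^# ** X k0).
  by rewrite -[X in homog s v X _](addNr k0); apply: homog_mul => //; exact: homog_star.
apply: (cn_homog0_le hv hXX) => //; last exact: exprn_ge0.
  by rewrite cs_starM cs_starK.
move=> xi hxi; rewrite actM.
have h1 := graded_component (phi := id) uD (fun _ _ => id) hX k0D hxi.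
have hstar : c^# = \sum_(k <- D) (X k)^#.
  by apply: (big_morph (@cs_star R A)); [exact: cs_starD | exact: cs_star0].
have h2 := graded_component (phi := -%R) uD oppr_inj
  (fun k => homog_star (hX k)) k0D (homog_grade (hX k0) hxi).
rewrite -hstar in h2; rewrite (le_trans h2) // (le_trans (act_le _ _)) //.
have -> : cn (pi c^#) = cn (pi c) by case: hpi => _ _ ->; rewrite cn_star.
rewrite expr2 -mulrA ler_wpM2l // (le_trans h1) //; exact: act_le.
Qed.

End GradedBounds.

(** * Faithfulness on corners and regular ideals *)

Section PolynomialGrowth.
Variables (R : realType) (L : Ngraph) (H : set (vertex L)).
Hypotheses (L_row_finite : row_finite L) (L_no_sources : no_sources L).
Hypothesis H_hered : hereditary H.
Variables (A : cstar_alg R) (s : mor L -> A).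
Hypothesis hs : CK_family s.
Local Notation Y := ((degree -> mor L) * (nat -> int))%type.
Variable pi : A -> bop_cstar R Y.
Hypotheses (hpi : star_hom pi) (pi_s : forall f, pi (s f) = path_rep R H_hered f).
Variable v : vertex L.
Hypothesis v_reaches : reaches H v.
Implicit Types (a b x : A) (f g : mor L).

Definition corner := ck_span s (fun f g => [/\ rng f = v, rng g = v & src f = src g]).

Lemma corner_mul x y : corner x -> corner y -> corner (x ** y).
Proof.
apply: ck_span_mul => f g f' g' [rf rg sfg] [rf' rg' sfg'].
apply: ck_span_sub (ck_gen_mul L_row_finite hs sfg sfg') => F G [-> -> -> _].
by rewrite rf rg'.
Qed.

Lemma corner_star x : corner x -> corner x^#.
Proof. by apply: ck_span_star => f g []. Qed.

Local Notation term := ((nat -> int) * A)%type.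

Lemma corner_decomposition a : corner a -> exists l : seq term,
  (forall p, p \in l -> homog s v p.1 p.2) /\ a = \sum_(p <- l) p.2.
Proof.
elim=> [|x y _ [l1 [h1 ->]] _ [l2 [h2 ->]]|c f g [rf rg sfg]].
- by exists [::]; rewrite big_nil.
- exists (l1 ++ l2); rewrite big_cat; split=> // p; rewrite mem_cat.
  by case/orP; [exact: h1 | exact: h2].
- exists [:: (zdeg f g, c *: (s f ** (s g)^#))]; rewrite big_seq1; split=> // p.
  by rewrite inE => /eqP -> /=; apply: ck_span_gen; split.
Qed.

Section Powers.
Variables (a : A) (l : seq term).
Hypotheses (hl : forall p, p \in l -> homog s v p.1 p.2) (aE : a = \sum_(p <- l) p.2).
Local Notation r := (size l).

(* The degrees occurring in a^n are determined by the multiplicities of the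
   degrees occurring in a, hence are polynomially many. *)
Let mult (m : 'I_r -> nat) : nat -> int :=
  \sum_(i < r) (nth (0, 0) l i).1 *+ m i.

Let mult_delta p : p \in l -> exists i0 : 'I_r, p.1 = mult (fun i => (i == i0)%N).
Proof.
move=> pl; have i0 : (index p l < r)%N by rewrite index_mem.
exists (Ordinal i0); rewrite /mult (bigD1 (Ordinal i0)) //= eqxx mulr1n nth_index //.
by rewrite big1 ?addr0 // => i /negbTE ->; rewrite mulr0n.
Qed.

Let power_terms n : exists T : seq term,
  (forall p, p \in T -> homog s v p.1 p.2 /\
     exists2 m : 'I_r -> nat, forall i, (m i <= n.+1)%N & p.1 = mult m) /\
  cs_pow a n = \sum_(p <- T) p.2.
Proof.
elim: n => [|n [T [hT TE]]].
  exists l; split=> // p pl; split; first exact: hl.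
  have [i0 e] := mult_delta pl; exists (fun i => (i == i0)%N) => // i.
  by case: (i == i0).
exists [seq (p.1 + q.1, p.2 ** q.2) | p <- l, q <- T]; split.
  move=> p /allpairsP[[p1 q1] /= [pl qT ->]] /=.
  have [hq [m hm qE]] := hT _ qT; split; first exact: homog_mul (hl pl) hq.
  have [i0 e] := mult_delta pl; exists (fun i => ((i == i0) + m i)%N) => [i|].
    by have := hm i; case: (i == i0); lia.
  by rewrite e qE /mult -big_split; apply: eq_bigr => i _; rewrite mulrnDr.
rewrite big_allpairs_dep /= TE {1}aE cs_mul_suml; apply: eq_bigr => p _.
by rewrite cs_mul_sumr.
Qed.

Lemma cn_pow_le n :
  cn (cs_pow a n) <= n.+2%:R ^+ r * cn (pi (cs_pow a n)).
Proof.
have [T [hT TE]] := power_terms n.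
(* The terms of a^(n+1) have multiplicities from 0 to n + 1, which gives (n + 2)^r tuples; different
   tuples may yield the same degree, whence the [undup] below. *)
pose deg_of (m : {ffun 'I_r -> 'I_n.+2}) := mult (fun i => m i).
pose D := undup (codom deg_of).
have uD : uniq D by exact: undup_uniq.
have TD p : p \in T -> p.1 \in D.
  move=> /hT[_ [m hm ->]]; rewrite mem_undup; apply/codomP.
  exists [ffun i => inord (m i)]; apply: eq_bigr => i _.
  by rewrite ffunE inordK // ltnS.
pose X k := \sum_(p <- T | p.1 == k) p.2.
have hX k : homog s v k (X k).
  by apply: ck_span_sum => p pT /eqP <-; have [] := hT _ pT.
have XE : cs_pow a n = \sum_(k <- D) X k.
  rewrite TE /X; under [RHS]eq_bigr do rewrite big_mkcond.
  rewrite exchange_big /= big_seq [RHS]big_seq; apply: eq_bigr => p pT.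
  rewrite (bigD1_seq p.1) ?TD //= eqxx big1 ?addr0 // => k.
  by rewrite eq_sym => /negbTE ->.
rewrite {1}XE (le_trans (cn_sum _ _ _)) //.
apply: (@le_trans _ _ (\sum_(k <- D) cn (pi (cs_pow a n)))).
  rewrite big_seq [leRHS]big_seq; apply: ler_sum => k kD; rewrite XE.
  exact: (cn_component L_row_finite hs hpi pi_s L_no_sources v_reaches uD hX kD).
rewrite big_const_seq count_predT iter_addr_0 -[leLHS]mulr_natl ler_wpM2r ?cn_ge0 //.
rewrite -natrX ler_nat (leq_trans (size_undup _)) // size_codom.
by rewrite card_ffun !card_ord.
Qed.

End Powers.

Lemma corner_cn_le a : corner a -> cn a <= cn (pi a).
Proof.
have sa x : corner x -> x^# = x -> cn x <= cn (pi x).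
  move=> /corner_decomposition[l [hl xE]] xs.
  apply: (@cn_le_of_pow _ _ _ _ 1 (size l)) => // [|n]; first exact: cn_ge0.
  rewrite mul1r (le_trans (cn_pow_le hl xE n)) // ler_wpM2l ?exprn_ge0 //.
  elim: n => [|n IHn]; first by rewrite expr1.
  rewrite /= exprS; case: (hpi) => _ -> _; rewrite (le_trans (cnM _ _)) //.
  by rewrite ler_wpM2l ?cn_ge0.
move=> ha; rewrite -(@ler_pXn2r _ 2) ?nnegrE ?cn_ge0 // -!cn_starM.
rewrite (le_trans (sa _ _ _)) //.
- by apply: corner_mul => //; exact: corner_star.
- by rewrite cs_starM cs_starK.
- by case: hpi => _ -> ->.
Qed.

Hypothesis s_gen : generates (range s).

(** The limits of the span form a closed *-subalgebra containing each s_f = s_f p_{src f}^#, hence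
    everything by generation. *)
Lemma ck_span_dense x e : 0 < e ->
  exists2 a, ck_span s (fun f g => src f = src g) a & cn (x - a) < e.
Proof.
pose P f g := src f = src g.
pose D := [set x : A | forall e, 0 < e -> exists2 a, ck_span s P a & cn (x - a) < e].
have SD a : ck_span s P a -> D a.
  by move=> ha e' e0; exists a => //; rewrite subrr cn0.
suff DT : D = setT.
  have Dx : D x by rewrite DT.
  exact: Dx.
apply: s_gen.
- move=> y hy e' e0; have e2 : 0 < e' / 2 by rewrite divr_gt0.
  have e2c : 0 < (e' / 2)%:C :> R[i] by rewrite ltcR.
  have [z [/(_ _ e2)[a ha za] yz]] := hy _ (nbhsx_ballx y _ e2c).
  exists a => //; rewrite -(subrKA z) (le_lt_trans (cnD _ _)) // [e']splitr ltrD //.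
  by move: yz; rewrite -ball_normE /= cnE ltcR.
- split; first split.
  + exact/SD/ck_span0.
  + move=> c y z hy hz e' e0; have e2 : 0 < e' / 2 by rewrite divr_gt0.
    have c0 : 0 < complex.Re `|c| + 1 by rewrite ltr_wpDl ?Re_norm_ge0.
    have [a ha ya] := hy _ (divr_gt0 e2 c0); have [b hb zb] := hz _ e2.
    exists (c *: a + b); first by apply: ck_spanD => //; exact: ck_span_scale.
    rewrite opprD addrACA -scalerBr (le_lt_trans (cnD _ _)) // [e']splitr.
    rewrite ler_ltD // cnZ; rewrite ltr_pdivlMr // in ya.
    rewrite (le_trans _ (ltW ya)) // mulrC ler_wpM2l ?cn_ge0 //.
    by rewrite lerDl.
  + move=> y z hy hz e' e0.
    have [b hb zb] := hz 1 ltr01; have b0 : 0 < cn b + 1 by rewrite ltr_wpDl ?cn_ge0.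
    have y0 : 0 < cn y + 1 by rewrite ltr_wpDl ?cn_ge0.
    have e2 : 0 < e' / 2 by rewrite divr_gt0.
    (* The approximant of z is chosen first, with tolerance set by |y|; that of y comes second, with
       tolerance set by the norm of the chosen [b']. *)
    have [b' hb' zb'] := hz _ (divr_gt0 e2 y0).
    have b0' : 0 < cn b' + 1 by rewrite ltr_wpDl ?cn_ge0.
    have [a ha ya] := hy _ (divr_gt0 e2 b0').
    exists (a ** b').
      apply: ck_span_mul ha hb' => f g f' g' hfg hfg'.
      by apply: ck_span_sub (ck_gen_mul L_row_finite hs hfg hfg') => F G [].
    have -> : y ** z - a ** b' = y ** (z - b') + (y - a) ** b'.
      by rewrite cs_mulBr cs_mulBl subrKA.
    rewrite (le_lt_trans (cnD _ _)) // [e']splitr ler_ltD //.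
      rewrite (le_trans (cnM _ _)) //; rewrite ltr_pdivlMr // in zb'.
      by rewrite (le_trans _ (ltW zb')) // mulrC ler_wpM2l ?cn_ge0 // lerDl.
    rewrite (le_lt_trans (cnM _ _)) //; rewrite ltr_pdivlMr // in ya.
    by rewrite (le_lt_trans _ ya) // ler_wpM2l ?cn_ge0 // lerDl.
  + move=> y hy e' e0; have [a ha ya] := hy _ e0.
    exists a^#; first by apply: ck_span_star ha => f g; rewrite /P.
    by rewrite -cs_starB cn_star.
- move=> _ [f _ <-]; apply: SD; rewrite -(ck_idr hs f) -(CK1_proj hs (src f)).1.
  by apply: ck_span_gen1; rewrite /P src_idm.
Qed.

Lemma corner_compress a : ck_span s (fun f g => src f = src g) a ->
  corner (s (idm v) ** a ** s (idm v)).
Proof.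
have [vs vv] := CK1_proj hs v.
elim=> [|x y _ h1 _ h2|c f g sfg].
- by rewrite cs_mul0r cs_mul0l; exact: ck_span0.
- by rewrite cs_mulDr cs_mulDl; exact: ck_spanD.
rewrite cs_scaler cs_scalel; apply: ck_span_scale.
rewrite cs_mulA -(cs_mulA (_ ** _)).
have [rf|rf] := eqVneq (rng f) v; last first.
  rewrite (CK2_zero hs) ?cs_mul0l; first exact: ck_span0.
  by rewrite src_idm => e; rewrite e eqxx in rf.
have [rg|rg] := eqVneq (rng g) v; last first.
  have vg : s (idm v) ** s g = 0.
    by apply: (CK2_zero hs); rewrite src_idm => e; rewrite e eqxx in rg.
  by rewrite -{2}vs -cs_starM vg cs_star0 cs_mul0r; exact: ck_span0.
have vf : s (idm v) ** s f = s f by rewrite -rf (ck_idl hs).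
have gv : (s g)^# ** s (idm v) = (s g)^# by rewrite -rg (ck_adj_idr hs).
by rewrite vf gv; exact: ck_span_gen1.
Qed.

(** The estimate of [corner_cn_le] is known only on the algebraic span. For a compressed approximant
    a of b, pi a = - pi (b - a) is small by contractivity; hence a is small, and so is b. *)
Lemma corner_faithful b : s (idm v) ** b ** s (idm v) = b -> pi b = 0 -> b = 0.
Proof.
move=> bv pb; apply: cn_eq0; apply/eqP; rewrite eq_le cn_ge0 andbT.
apply/ler_addgt0Pl => e e0; rewrite addr0.
have e2 : 0 < e / 2 by rewrite divr_gt0.
have [a0 ha0 ba0] := ck_span_dense b e2.
pose a := s (idm v) ** a0 ** s (idm v).
have ba : cn (b - a) <= e / 2.
  rewrite -bv /a -cs_mulBl -cs_mulBr (le_trans _ (ltW ba0)) //.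
  have p1 : cn (s (idm v)) <= 1 by exact: cn_ck.
  rewrite (le_trans (cnM _ _)) // (le_trans (ler_piMr (cn_ge0 _) p1)) //.
  by rewrite (le_trans (cnM _ _)) // ler_piMl ?cn_ge0.
have a1 : cn a <= e / 2.
  rewrite (le_trans (corner_cn_le (corner_compress ha0))) //.
  rewrite (_ : pi _ = - pi (b - a)); last first.
    by rewrite (star_homB hpi) pb sub0r opprK.
  by rewrite cnN (le_trans (star_hom_contractive hpi _)).
rewrite -(subrK a b) (le_trans (cnD _ _)) // [e]splitr; exact: lerD.
Qed.

(* If y passes through H at degree n, then the coordinate of pi(b) xi at y is a
   coordinate of pi(s_f^* b) xi for f = y(0, n). *)
Lemma corner_eq0 b : s (idm v) ** b ** s (idm v) = b ->
  (forall f, H (src f) -> (s f)^# ** b = 0) -> b = 0.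
Proof.
move=> bv hb; apply: corner_faithful => //.
apply: bop_ext => xi; apply: l2_ext => -[y e].
have -> : (0 : bop_cstar R Y) = 0 :> bop R Y by [].
rewrite bop0E l20 -[LHS]/(act pi b xi (y, e)).
have [ey|ney] := pselect (enters H y.1); last first.
  rewrite -bv -cs_mulA (actM hpi) (act_s pi_s) del_idm asboolF // => -[] //.
have [_ [n hn]] := ey; have := hb _ hn => h0.
have dn : deg (y.1 n) = n by have [[]] := ey.
have : act pi ((s (y.1 n))^# ** b) xi (shift n y.1, y.2 - dz n, e) = 0.
  by rewrite h0 (act0 hpi).
rewrite (actM hpi) (act_adj hpi pi_s).
rewrite (_ : ins H (y.1 n) _ = Some y) //.
by apply/del_ins => //; rewrite /del asboolT ?dn //; split.
Qed.

End PolynomialGrowth.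

(** * Segments of paths and aperiodicity of the restricted graph *)

Section Segments.
Variable L : Ngraph.
Implicit Types (f g : mor L) (m n p q : degree).

Lemma segmentP f p q : (p `<=` q)%mset -> (q `<=` deg f)%mset ->
  is_segment f p q (segment f p q).
Proof.
move=> pq qf; have [h1 h2 h3] := split_atP (msubset_trans pq qf).
have hq : ((q `\` p) `<=` deg (rest f p))%mset.
  have := congr1 (@deg _) h2; rewrite deg_comp // h3 => e.
  apply/msubsetP => i; move/msubsetP/(_ i): qf; rewrite e !msetE2; lia.
have [k1 k2 k3] := split_atP hq.
rewrite /segment; apply: (@xgetI _ f [set g | is_segment f p q g]
  (init (rest f p) (q `\` p)%mset)).
exists (init f p), (rest (rest f p) (q `\` p)%mset).
by split; rewrite -?k2 //; rewrite h1 {1}k2 rng_comp.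
Qed.

(** Cut fg at degree p + deg f in two ways: after a1 followed by the first deg f of a, and after f
    b1. Unique factorization identifies the remainders, then their initial parts of degree l. *)
Lemma rest_segment f g p l a b : src f = rng g ->
  is_segment (mcomp f g) p (p `+` (deg f `+` l))%mset a ->
  is_segment g p (p `+` l)%mset b -> rest a (deg f) = b.
Proof.
move=> fg [a1 [a2 [h1 h2 h3 h4 h5]]] [b1 [b2 [k1 k2 k3 k4 k5]]].
rewrite msetDKB in h5; rewrite msetDKB in k5.
have [|c1 c2 c3] := @split_atP _ a (deg f); first by rewrite h5 msubset_addr.
have d1 : src a1 = rng (init a (deg f)) by rewrite h1 {1}c2 rng_comp.
have d2 : src (rest a (deg f)) = rng a2 by rewrite -(src_comp c1) -c2.
have d3 : src f = rng b1 by rewrite fg k3 rng_comp // rng_comp.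
have [||||_] := @mcomp_inj _ (mcomp a1 (init a (deg f)))
  (mcomp (rest a (deg f)) a2) (mcomp f b1) (mcomp b b2).
- by rewrite src_comp // rng_comp.
- by rewrite src_comp // rng_comp.
- rewrite -!Defs.compA ?rng_comp // -k3.
  by rewrite (Defs.compA c1) // -c2 -h3.
- by rewrite !deg_comp // c3 h4 k4 msetDC.
move=> /mcomp_inj[] //; apply: (can_inj (msetDKB (deg f))).
by rewrite k5 -[RHS]h5 {2}c2 deg_comp // c3.
Qed.

End Segments.

Section Restriction.
Variables (L : Ngraph) (H : set (vertex L)) (H_hered : hereditary H).

Lemma is_segmentD (f g : mor (NgraphD H_hered)) p q :
  is_segment f p q g -> is_segment (val f : mor L) p q (val g : mor L).
Proof.
move=> [g1 [g2 [h1 h2 h3 h4 h5]]]; exists (val g1), (val g2).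
have e1 := srcD_rngD h1; have e2 := srcD_rngD h2.
split=> //; rewrite h3 /= val_compD ?val_compD //.
by apply: val_inj; rewrite /= val_compD // rng_comp.
Qed.

(** By [rest_segment], deleting the first deg f from the segment of fg at p leaves the segment of g
    at p, for p = m and p = n alike; equal segments of fg would thus give equal segments of g. The
    composite survives in the restricted graph because [src g] avoids [H] by the choice of f. *)
Lemma aperiodicD : aperiodic L ->
  (forall v : vertex L, v \notin H -> exists2 f, rng f = v &
     forall g, rng g = src f -> src g \notin H) ->
  aperiodic (NgraphD H_hered).
Proof.
move=> ap esc v m n mn; have [f rf hf] := esc (val v) (valP v).
have [g [rg dg ne]] := ap (src f) m n mn.
have fg : src f = rng g by rewrite rg.
have hF : (rng (mcomp f g) \notin H) && (src (mcomp f g) \notin H).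
  by rewrite rng_comp // src_comp // rf (valP v) hf.
pose F : mor (NgraphD H_hered) := Sub (mcomp f g) hF.
have dF : deg F = (deg f `+` deg g)%mset by rewrite /= /degD /= deg_comp.
pose l := (deg g `\` (m `|` n))%mset.
have E1 p : ((p `+` deg g) `\` (m `|` n))%mset = (p `+` l)%mset.
  apply/msetP => i; move/msubsetP/(_ i): dg; rewrite !msetE2; lia.
have E2 p : ((p `+` deg F) `\` (m `|` n))%mset = (p `+` (deg f `+` l))%mset.
  apply/msetP => i; rewrite dF; move/msubsetP/(_ i): dg; rewrite !msetE2; lia.
have mp : (m `<=` m `|` n)%mset := msubsetUl _ _.
have np : (n `<=` m `|` n)%mset := msubsetUr _ _.
have key p : (p `<=` m `|` n)%mset ->
    rest (val (segment F p (p `+` (deg f `+` l))%mset) : mor L) (deg f) =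
    segment g p (p `+` l)%mset.
  move=> pp; apply: (rest_segment fg (a := val _) (p := p) (l := l)); last first.
    apply: segmentP; first exact: msubset_addr.
    apply/msubsetP => i; move/msubsetP/(_ i): dg; move/msubsetP/(_ i): pp.
    by rewrite !msetE2; lia.
  apply: (@is_segmentD F); apply: segmentP; first exact: msubset_addr.
  apply/msubsetP => i; rewrite dF; move/msubsetP/(_ i): dg; move/msubsetP/(_ i): pp.
  by rewrite !msetE2; lia.
exists F; split.
- by apply: val_inj; rewrite /= rng_comp.
- apply/msubsetP => i; rewrite dF; move/msubsetP/(_ i): dg; rewrite !msetE2; lia.
- rewrite !E2 => e; apply: ne; rewrite !E1 -!key //; by rewrite e.
Qed.

End Restriction.

(** * Regularity puts vertices that keep reaching H into H *)

Section RegularIdeals.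
Variables (R : realType) (L : Ngraph).
Hypotheses (L_row_finite : row_finite L) (L_no_sources : no_sources L).
Variables (A : cstar_alg R) (s : mor L -> A) (hA : is_graph_cstar s) (J : set A).
Hypothesis J_regular : regular_ideal J.

(** When [src f] is in the vertex set, s_f^# = p_{src f} s_f^# lies in [J], so every b in the
    annihilator has s_f^# b = 0. This is the hypothesis of [corner_eq0]: the annihilator meets the
    corner at [v] only in 0. *)
Lemma regular_vertex v : reaches (vertices_of s J) v -> vertices_of s J v.
Proof.
move=> hv; have hs := gc_CK hA.
have H_hered := regular_ideal_hereditary hA J_regular.
have [pi [hpi pi_s]] := gc_univ hA (path_rep_CK R L_row_finite H_hered).
have [[subJ idJ] JE] := J_regular.
have [vs vv] := CK1_proj hs v.
have hJ f : vertices_of s J (src f) -> J (s f)^#.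
  by move=> hf; rewrite -(ck_adj_idl hs); apply: (idJ _ _ hf).2.
have zero b : s (idm v) ** b ** s (idm v) = b -> annihilator J b -> b = 0.
  move=> bv bJ; apply: (corner_eq0 L_row_finite L_no_sources hs hpi pi_s hv
    (gc_gen hA) bv) => f /hJ hf.
  exact: (bJ _ hf).2.
have annl x a : annihilator J x -> annihilator J (a ** x).
  move=> hx y Jy; split; first by rewrite -cs_mulA (hx y Jy).1 cs_mul0r.
  by rewrite cs_mulA (hx _ (idJ a y Jy).2).2.
have annr x a : annihilator J x -> annihilator J (x ** a).
  move=> hx y Jy; split; last by rewrite cs_mulA (hx y Jy).2 cs_mul0l.
  by rewrite -cs_mulA (hx _ (idJ a y Jy).1).1.
(* The products (p_v a)(p_v a)^# and (a p_v)^# (a p_v) are in the corner and, the annihilator being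
   an ideal, in the annihilator; so both vanish, and the C*-identity gives p_v a = a p_v = 0. *)
rewrite /vertices_of /= -JE => a aJ; split.
- apply: cs_Mstar_eq0; apply: zero.
    by rewrite cs_starM vs !cs_mulA vv -!cs_mulA vv.
  by apply: annr; apply: annl.
- apply: cs_starM_eq0; apply: zero.
    by rewrite cs_starM vs !cs_mulA vv -!cs_mulA vv.
  by apply: annl; apply: annr.
Qed.

End RegularIdeals.

Theorem theorem5p3 (R : realType) (L : Ngraph)
    (L_row_finite : row_finite L) (L_no_sources : no_sources L)
    (L_aperiodic : aperiodic L)
    (A : cstar_alg R) (s : mor L -> A) (hA : is_graph_cstar s)
    (J : set A) (J_regular : regular_ideal J)
    (J_gauge : gauge_invariant hA J) :
  aperiodic (NgraphD (regular_ideal_hereditary hA J_regular)).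
Proof.
(* If no path from [v] leads to a vertex whose descendants all avoid the vertex set of [J], then
   every path from [v] extends into it, and [regular_vertex] puts [v] there. *)
apply: aperiodicD => // v vH; apply: contrapT => hv.
have : vertices_of s J v; last by move/mem_set; apply/negP.
apply: (regular_vertex L_row_finite L_no_sources hA J_regular) => f rf.
apply: contrapT => hf; apply: hv; exists f => // g rg.
by apply/negP => /set_mem hg; apply: hf; exists g.
Qed.
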